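(* Let $q$ be a prime power, $m\ge 2$ an integer not divisible by the characteristic of $\mathbb{F}_q$, and $f(x)\in\mathbb{F}_q[x]$ a polynomial with $\deg(f)\ge 2$, all of whose roots lie in $\mathbb{F}_q$, which is not a $d$-th power of an element of $\mathbb{F}_q(x)$ for any divisor $d>1$ of $m$. Let $\mathcal{X}: y^m=f(x)$, with function field $F=\mathbb{F}_q(\mathcal{X})=\mathbb{F}_q(x,y)$. Let $P_1,\dots,P_r$ be the (distinct) places of $\mathbb{F}_q(x)$ that are zeros or poles of $f(x)$, and $\lambda_k=\nu_{P_k}(f(x))$ for $1\le k\le r$. Let $n\le r$ be such that $P_1,\dots,P_n$ are totally ramified in $F/\mathbb{F}_q(x)$, let $Q_k$ be the unique place of $F$ over $P_k$ for $1\le k\le n$, and let $\mathbf{Q}=(Q_1,\dots,Q_n)$. For $1\le i\le m-1$ and $1\le k\le n$ put $$t_k(i)=(i\lambda_k)\bmod m,\qquad \beta(i)=\sum_{k=1}^{r}\left\lceil\frac{i\lambda_k}{m}\right\rceil-1 .$$ Assume $2\le n\le q$. Let $\Upsilon$ denote either $\Gamma$ or $\Lambda$, and let $\rho=0$ if $\Upsilon=\Gamma$ and $\rho=n-2$ if $\Upsilon=\Lambda$. Then $$\widehat{\Upsilon}(\mathbf{Q})=\left\{(mj_1+t_1(i),\dots,mj_n+t_n(i)) : 1\le i\le m-1,\ j_1,\dots,j_n\in\mathbb{Z},\ j_1+\cdots+j_n=\beta(i)+1-n+\rho\right\}$$ $$\cup\ \left\{(mj_1,\dots,mj_n): j_1,\dots,j_n\in\mathbb{Z},\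 j_1+\cdots+j_n=\rho\right\}.$$
   Context: For integers $a,b$, $b\bmod a$ is the smallest non-negative integer congruent to $b$ modulo $a$. $\nu_P$ is the discrete valuation at a place $P$. Let $F/\mathbb{F}_q$ be a function field and $\mathbf{Q}=(Q_1,\dots,Q_n)$ an $n$-tuple of distinct rational places. Let $R_{\mathbf{Q}}$ be the ring of functions in $F$ regular outside $\{Q_1,\dots,Q_n\}$. The generalized Weierstrass semigroup is $$\widehat{H}(\mathbf{Q})=\{(-\nu_{Q_1}(z),\dots,-\nu_{Q_n}(z))\in\mathbb{Z}^n : z\in R_{\mathbf{Q}}\setminus\{0\}\}.$$ Let $I=\{1,\dots,n\}$. For a nonempty $J\subsetneq I$ and $\alpha\in\mathbb{Z}^n$ let $$\nabla_J(\alpha)=\{\beta\in\widehat{H}(\mathbf{Q}) : \beta_j=\alpha_j \text{ for } j\in J,\ \beta_i<\alpha_i \text{ for } i\notin J\},\qquad \nabla(\alpha)=\bigcup_{i=1}^n\nabla_{\{i\}}(\alpha).$$ An element $\alpha\in\widehat{H}(\mathbf{Q})$ is maximal if $\nabla(\alpha)=\emptyset$. It is absolute maximal if it is maximal and $\nabla_J(\alpha)=\emptyset$ for every $J\subsetneq I$ with $|J|\ge 2$; it is relative maximal if it is maximal and $\nabla_J(\alpha)\ne\emptyset$ for every $J\subsetneq I$ with $|J|\ge2$. $\widehat{\Gamma}(\mathbf{Q})$ and $\widehat{\Lambda}(\mathbf{Q})$ denote the sets of absolute maximal and relative maximal elements of $\widehat{H}(\mathbf{Q})$, respectively. *)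

(* Defs.v *)
From HB Require Import structures.
From mathcomp Require Import all_boot all_order all_algebra all_field.
From mathcomp Require Import boolp classical_sets.

Set Implicit Arguments.
Unset Strict Implicit.
Unset Printing Implicit Defensive.

Import Order.TTheory GRing.Theory Num.Theory.

Local Open Scope classical_set_scope.
Local Open Scope ring_scope.

Section Places.
Variables (K E : fieldType) (c : {rmorphism K -> E}).

(* A place of E/K is represented by its valuation ring, which determines it:
   a ring K < O < E such that z or z^-1 lies in O for every z in E. *)
Record place := Place {
  vring : set E;
  vring_subring : subring_closed (mem vring);
  vring_const : range c `<` vring;
  vring_proper : vring `<` [set: E];
  vring_total : forall z, vring z \/ vring z^-1 }.

(* The test u != 0 is needed because 0^-1 = 0 in MathComp. *)
Definition vunit (P : place) : set E :=
  [set u | [/\ u != 0, vring P u & vring P u^-1]].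

Definition maxideal (P : place) : set E := vring P `\` vunit P.

Definition uniformizer (P : place) (t : E) : Prop :=
  maxideal P = [set t * w | w in vring P].

(* Normalized discrete valuation: nu P (t ^ k * u) = k for t a uniformizer and
   u a unit. Only meant for z != 0 (nu P 0 is the dummy value 0, not
   infinity). *)
Definition nu (P : place) (z : E) : int :=
  xget 0 [set k : int |
    exists t u, [/\ uniformizer P t, vunit P u & z = t ^ k * u]].

Section Semigroup.
Variables (n : nat) (Q : 'I_n -> place).

Definition regular_outside : set E :=
  [set z | forall P : place, (forall k, P <> Q k) -> vring P z].

Definition wsemigroup : set 'rV[int]_n :=
  [set \row_k - nu (Q k) z | z in regular_outside `\ 0].

Definition nablaJ (J : {set 'I_n}) (a : 'rV[int]_n) : set 'rV[int]_n :=
  [set b | [/\ wsemigroup b,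
               forall j, j \in J -> b 0 j = a 0 j
             & forall i, i \notin J -> b 0 i < a 0 i]].

Definition nabla (a : 'rV[int]_n) : set 'rV[int]_n :=
  \bigcup_(i : 'I_n) nablaJ [set i]%SET a.

Definition maximal : set 'rV[int]_n :=
  [set a | wsemigroup a /\ nabla a = set0].

Definition absolute_maximal : set 'rV[int]_n :=
  [set a | maximal a /\ forall J : {set 'I_n},
     J \proper [set: 'I_n]%SET -> (2 <= #|J|)%N -> nablaJ J a = set0].

Definition relative_maximal : set 'rV[int]_n :=
  [set a | maximal a /\ forall J : {set 'I_n},
     J \proper [set: 'I_n]%SET -> (2 <= #|J|)%N -> nablaJ J a !=set0].

End Semigroup.
End Places.

Section Extensions.
Variables (K : fieldType) (F : fieldExtType {fraction {poly K}}).

Definition ratfun_const : {rmorphism K -> {fraction {poly K}}} :=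
  @tofrac {poly K} \o polyC.

Definition ext_const : {rmorphism K -> F} := in_alg F \o ratfun_const.

Definition lies_over (Q : place ext_const) (P : place ratfun_const) : Prop :=
  forall z, maxideal P z <-> maxideal Q z%:A.

Definition ramification_index (Q : place ext_const) (P : place ratfun_const)
    (e : nat) : Prop :=
  forall z, z != 0 -> nu Q z%:A = e%:Z * nu P z.

Definition totally_ramified (P : place ratfun_const) : Prop :=
  exists Q : place ext_const,
    [/\ lies_over Q P,
        forall Q', lies_over Q' P -> Q' = Q
      & ramification_index Q P (\dim {:F})].

End Extensions.

(* Main.v *)
(** Write z in F as sum_(i < m) a_i y^-i with rational a_i.

    Total ramification at Q_k forces lambda_k to be prime to m, so the terms
    of this sum have pairwise distinct valuations at Q_k, and the valuation of
    z is the least of theirs. Conjugating y over the m-th roots of unity and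
    averaging shows that z is regular outside the Q_k if and only if every term
    a_i y^-i is. Since principal divisors of K(x) have degree 0, and since
    n <= q leaves a rational point of the line free to absorb superfluous zeros,
    the pole orders of the nonzero terms a y^-i form exactly the set of vectors
    (m j_k + t_k(i))_k with sum_k j_k >= s_i, where s_i = beta(i) + 1 - n for
    i > 0 and s_0 = 0. The semigroup therefore consists of the componentwise
    maxima of such vectors. As the residue mod m of one coordinate determines
    i, emptiness of nabla_J at a vector of class i amounts to
    sum_k j_k < s_i + n - #|J|, from which both descriptions follow. *)

Require Import Defs.
From HB Require Import structures.
From mathcomp Require Import all_boot all_order all_algebra all_field.
From mathcomp Require Import boolp classical_sets.
From mathcomp Require Import cyclic ring zify.

Set Implicit Arguments.
Unset Strict Implicit.
Unset Printing Implicit Defensive.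

Import Order.TTheory GRing.Theory Num.Theory.

Local Open Scope classical_set_scope.
Local Open Scope ring_scope.

(** A place is a bare valuation ring and [nu] has a default value, so discreteness must be secured
    before any valuation is computed: over K(x) it comes from the center of the place, at Q_k from
    the nonzero values that the ramification index forces on [nu]. The degree of F is not given
    either: that it equals m comes out of the hypothesis on d-th powers. K need not contain the m-th
    roots of unity, so F may lack the automorphisms over which one would average. The conjugates are
    formed in a larger field L, and their integrality is obtained by pulling a valuation ring of L
    back to F along the embeddings y -> w y. Chevalley's argument supplies that ring; it also stands
    in for a classification of the places of K(x), of which only the rational points and infinity
    are ever described. Negative powers of y are chosen because the pole order of a y^-i at Q_k is i
    lambda_k - m nu(a), whose residue modulo m is t_k(i) itself. *)

(** * Maximal elements of a union of residue classes *)

Section Maximal.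
Variables (K E : fieldType) (c : {rmorphism K -> E}).
Variables (n : nat) (Q : 'I_n -> place c) (m : int) (I : Type).
Variables (T : I -> 'I_n -> int) (s : I -> int).
Hypotheses (m_gt0 : 0 < m) (n_ge2 : (2 <= n)%N).
Hypothesis T_inj : forall k i i' (j j' : int),
  m * j + T i k = m * j' + T i' k -> i = i'.
Hypothesis semigroupP : forall a : 'rV[int]_n, wsemigroup Q a <->
  forall k, exists i (j : 'I_n -> int), [/\ s i <= \sum_l j l,
    a 0 k = m * j k + T i k & forall l, m * j l + T i l <= a 0 l].

Let D i (j : 'I_n -> int) : 'rV[int]_n := \row_k (m * j k + T i k).

Let D_semigroup i (j : 'I_n -> int) : s i <= \sum_l j l -> wsemigroup Q (D i j).
Proof.
move=> le_s; apply/semigroupP => k; exists i, j; split=> //; first by rewrite mxE.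
by move=> l; rewrite mxE.
Qed.

(** Coordinates within a class move by multiples of m, so this indexes the greatest vector of the
    class that agrees with j on J and is smaller off J. *)
Let lower (J : {set 'I_n}) (j : 'I_n -> int) l : int := j l - (l \notin J)%:Z.

Let sum_lower J (j : 'I_n -> int) : \sum_l lower J j l = \sum_l j l - (n - #|J|)%N%:Z.
Proof.
rewrite big_split /=; congr (_ + _); rewrite sumrN; congr (- _).
have -> : (n - #|J|)%N = (\sum_(l < n) (l \notin J))%N.
  by rewrite -big_mkcond sum1_card -{1}(card_ord n) -(cardC (mem J)) addKn.
by rewrite (big_morph _ PoszD (erefl _)).
Qed.

Let lower_nabla i (J : {set 'I_n}) (j : 'I_n -> int) :
  s i + (n - #|J|)%N%:Z <= \sum_l j l -> nablaJ Q J (D i j) (D i (lower J j)).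
Proof.
move=> le_s; split; first by apply: D_semigroup; rewrite sum_lower lerBrDr.
  by move=> l lJ; rewrite !mxE /lower lJ subr0.
by move=> l lJ; rewrite !mxE /lower lJ /= mulrBr mulr1; lia.
Qed.

(** At a coordinate in J the class vector below b that attains b shares a value with [D i j]; by
    [T_inj] it has class i, and is then bounded by [lower J j]. *)
Let nabla_sum i (j : 'I_n -> int) (J : {set 'I_n}) b : (0 < #|J|)%N ->
  nablaJ Q J (D i j) b -> s i + (n - #|J|)%N%:Z <= \sum_l j l.
Proof.
move=> /card_gt0P[k kJ] [/semigroupP/(_ k)[i' [j' [le_s bk leb]]] eqJ ltJ].
have Ei : i = i'.
  by apply: (@T_inj k _ _ (j k) (j' k)); rewrite -bk eqJ // mxE.
subst i'; have : \sum_l j' l <= \sum_l lower J j l.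
  apply: ler_sum => l _; rewrite /lower; have := leb l; case: (boolP (l \in J)) => lJ.
    by rewrite eqJ // mxE; nia.
  by have := ltJ _ lJ; rewrite mxE; nia.
by rewrite sum_lower lerBrDr; apply: le_trans; rewrite lerD2r.
Qed.

Let nablaP i (j : 'I_n -> int) (J : {set 'I_n}) : (0 < #|J|)%N ->
  (nablaJ Q J (D i j) !=set0) <-> (s i + (n - #|J|)%N%:Z <= \sum_l j l).
Proof.
move=> J0; split=> [[b]|h]; first exact: nabla_sum.
by exists (D i (lower J j)); exact: lower_nabla.
Qed.

Let nablaD0 i (j : 'I_n -> int) (J : {set 'I_n}) : (0 < #|J|)%N ->
  nablaJ Q J (D i j) = set0 <-> \sum_l j l < s i + (n - #|J|)%N%:Z.
Proof.
move=> J0; rewrite ltNge; split=> [eq0|lt_s].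
  by apply/negP => /(nablaP _ _ J0)/set0P; rewrite eq0 eqxx.
by apply/eqP/negPn/negP => /set0P/(nablaP _ _ J0); exact/negP.
Qed.

Let nabla0P a : nabla Q a = set0 <-> forall k, nablaJ Q [set k]%SET a = set0.
Proof.
split=> [a0 k|a0].
  apply/eqP/negPn/negP => /set0P[b kb].
  have : nabla Q a b by exists k.
  by rewrite a0.
by apply/eqP/negPn/negP => /set0P[b [k _]]; rewrite a0.
Qed.

Let maximalD i (j : 'I_n -> int) : maximal Q (D i j) <-> s i <= \sum_l j l < s i + n%:Z - 1.
Proof.
have k0 : 'I_n by exists 0%N; lia.
split=> [[/semigroupP/(_ k0)[i' [j' [le_s]]]]|/andP[le_s lt_s]].
  rewrite mxE => /T_inj Ei; subst i' => leD /nabla0P/(_ k0).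
  rewrite nablaD0 cards1 // => lt_s.
  apply/andP; split; last by lia.
  apply: (le_trans le_s); apply: ler_sum => l _; have := leD l; rewrite mxE; nia.
split; first exact: D_semigroup.
by apply/nabla0P => k; rewrite nablaD0 cards1 //; lia.
Qed.

Lemma absolute_maximalE : absolute_maximal Q =
  [set a | exists i (j : 'I_n -> int), \sum_l j l = s i /\ a = \row_k (m * j k + T i k)].
Proof.
have k0 : 'I_n by exists 0%N; lia.
apply/seteqP; split=> a; last first.
  move=> [i [j [sj ->]]]; split; first by apply/maximalD; lia.
  move=> J Jp J2; rewrite nablaD0; last by lia.
  by move: (proper_card Jp); rewrite cardsT card_ord; lia.
move=> [[wa /nabla0P a0] abs].
have noJ (J : {set 'I_n}) : (0 < #|J| < n)%N -> nablaJ Q J a = set0.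
  move=> /andP[J0 Jn]; case: (ltnP 1 #|J|) => J1.
    by apply: abs => //; rewrite properEcard finset.subsetT cardsT card_ord.
  have /cards1P[k ->] : #|J| == 1%N by lia.
  exact: a0.
have /semigroupP/(_ k0)[i [j [le_s ak0 leD]]] := wa.
(* [D i j] lies below a and touches it exactly on J, hence belongs to [nablaJ Q J a]; absolute
   maximality leaves only the full J. *)
pose J := [set l | m * j l + T i l == a 0 l]%SET.
have Dnab : nablaJ Q J a (D i j).
  split; first exact: D_semigroup.
    by move=> l; rewrite inE mxE => /eqP.
  by move=> l; rewrite inE mxE lt_neqAle leD => ->.
have J0 : (0 < #|J|)%N by apply/card_gt0P; exists k0; rewrite inE ak0.
have JT : J = [set: 'I_n]%SET.
  apply/eqP; rewrite eqEcard finset.subsetT cardsT card_ord leqNgt /=; apply/negP => Jn.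
  by move: Dnab; rewrite noJ // J0.
have aD : a = D i j.
  apply/rowP => l; rewrite mxE; have : l \in J by rewrite JT inE.
  by rewrite inE => /eqP.
exists i, j; split=> //; apply/eqP; rewrite eq_le le_s andbT leNgt; apply/negP => lt_s.
(* The largest proper J, of size n - 1, gives the sharpest bound: the sum is less than s i + 1. *)
have cJ : #|[set~ k0]%SET| = n.-1 by rewrite cardsC1 card_ord.
have : nablaJ Q [set~ k0]%SET a !=set0.
  by rewrite aD nablaP cJ; lia.
by move=> /set0P; rewrite noJ ?eqxx // cJ; lia.
Qed.

Lemma relative_maximalE : relative_maximal Q =
  [set a | exists i (j : 'I_n -> int), \sum_l j l = s i + (n%:Z - 2) /\
                       a = \row_k (m * j k + T i k)].
Proof.
have k0 : 'I_n by exists 0%N; lia.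
apply/seteqP; split=> a; last first.
  move=> [i [j [sj ->]]]; split; first by apply/maximalD; lia.
  by move=> J Jp J2; rewrite nablaP; lia.
move=> [amax rel].
have [wa /nabla0P a0] := amax.
have properJ k l : (2 < n)%N -> [set k; l]%SET \proper [set: 'I_n]%SET.
  move=> n3; rewrite properEcard finset.subsetT cardsT card_ord (leq_ltn_trans _ n3) //.
  by rewrite cards2; case: eqP.
have /semigroupP/(_ k0)[i [j0 [_ ak0 leD0]]] := wa.
(* Every coordinate of a is in the class i found at [k0]. For n > 2, an element of nabla_{k0,l}(a)
   dominates a vector of class i that can meet a only at k0 and l; it does meet a at l, or it would
   lie in nabla_{k0}(a). For n = 2 no proper J has two elements, and a itself takes the place of
   that element. *)
have aclass l : exists jl, a 0 l = m * jl + T i l.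
  have [->|lk0] := eqVneq l k0; first by exists (j0 k0).
  have [n3|n2] := ltnP 2 n.
    have J2 : (2 <= #|[set k0; l]%SET|)%N by rewrite cards2 eq_sym lk0.
    have [b [/semigroupP/(_ k0)[i' [j [le_s bk0 leD]]] eqJ ltJ]] := rel _ (properJ k0 l n3) J2.
    have Ei : i = i'.
      by apply: (@T_inj k0 _ _ (j0 k0) (j k0)); rewrite -bk0 -ak0 eqJ // !inE eqxx.
    subst i'; exists (j l); apply: contrapT => nal.
    have : nablaJ Q [set k0]%SET a (D i j).
      split; first exact: D_semigroup.
        by move=> ?; rewrite inE => /eqP ->; rewrite mxE -bk0 eqJ // !inE eqxx.
      move=> h; rewrite inE mxE => hk0; have [->|hl] := eqVneq h l.
        rewrite lt_neqAle; apply/andP; split; first by apply/eqP => /esym.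
        by rewrite -(eqJ l) ?leD // !inE eqxx orbT.
      by apply: le_lt_trans (leD h) (ltJ _ _); rewrite !inE negb_or hk0.
    by rewrite a0.
  have /semigroupP/(_ k0)[i' [j [le_s ak0' leD]]] := wa.
  have Ei : i = i' by apply: (@T_inj k0 _ _ (j0 k0) (j k0)); rewrite -ak0' -ak0.
  subst i'; exists (j l); apply: contrapT => nal.
  have : nablaJ Q [set k0]%SET a (D i j).
    split; first exact: D_semigroup.
      by move=> ?; rewrite inE => /eqP ->; rewrite mxE.
    move=> h; rewrite inE mxE => hk0; have -> : h = l.
      apply: val_inj => /=; move: hk0 lk0; rewrite -!val_eqE /=.
      by move: (ltn_ord h) (ltn_ord k0) (ltn_ord l); lia.
    rewrite lt_neqAle leD andbT; apply/eqP => /esym; exact: nal.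
  by rewrite a0.
have [j aj] : {j : 'I_n -> int & forall l, a 0 l = m * j l + T i l}.
  by apply: choice aclass.
have aD : a = D i j by apply/rowP => l; rewrite mxE.
exists i, j; split=> //; have /maximalD/andP[le_s lt_s] : maximal Q (D i j) by rewrite -aD.
(* A J of size 2 bounds the sum below by s i + n - 2, which meets the upper bound from maximality;
   for n = 2 the two bounds of [maximalD] already coincide. *)
have [n3|n2] := ltnP 2 n; last by lia.
have k1 : 'I_n by exists 1%N; lia.
have [k1' k1k0] : exists k1', k1' != k0.
  have : (0 < #|[set~ k0]%SET|)%N by rewrite cardsC1 card_ord; lia.
  by move=> /card_gt0P[k']; rewrite !inE; exists k'.
have J2 : #|[set k0; k1']%SET| = 2 by rewrite cards2 eq_sym k1k0.
have := rel _ (properJ k0 k1' n3); rewrite J2 => /(_ isT); rewrite aD nablaP J2 //; lia.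
Qed.

End Maximal.

(** * Valuation rings and their valuations *)

Section ValuationRing.
Variables (K E : fieldType) (c : {rmorphism K -> E}) (P : place c).
Local Notation O := (vring P).

Lemma vring1 : O 1.
Proof. by have [/set_mem] := vring_subring P. Qed.

Lemma vringB x y : O x -> O y -> O (x - y).
Proof.
by move=> Ox Oy; have [_ + _] := vring_subring P; move/(_ x y (mem_set Ox) (mem_set Oy))/set_mem.
Qed.

Lemma vringM x y : O x -> O y -> O (x * y).
Proof.
by move=> Ox Oy; have [_ _] := vring_subring P; move/(_ x y (mem_set Ox) (mem_set Oy))/set_mem.
Qed.

Lemma vring0 : O 0.
Proof. by rewrite -(subrr 1); apply: vringB vring1 vring1. Qed.

Lemma vringN x : O x -> O (- x).
Proof. by move=> Ox; rewrite -sub0r; apply: vringB vring0 Ox. Qed.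

Lemma vringD x y : O x -> O y -> O (x + y).
Proof. by move=> Ox Oy; rewrite -[y]opprK; apply: vringB Ox (vringN Oy). Qed.

Lemma vring_sum (I : Type) (r : seq I) (p : pred I) (F : I -> E) :
  (forall i, p i -> O (F i)) -> O (\sum_(i <- r | p i) F i).
Proof. by move=> OF; apply: big_ind => //; [exact: vring0|exact: vringD]. Qed.

Lemma vringX x k : O x -> O (x ^+ k).
Proof.
move=> Ox; elim: k => [|k IHk]; first by rewrite expr0; exact: vring1.
by rewrite exprS; exact: vringM.
Qed.

Lemma vringC a : O (c a).
Proof. by case: (vring_const P) => + _; apply; exists a. Qed.

(** Valuation rings are integrally closed; this lets regularity be tested on m-th powers, which
    descend to the rational function field. *)
Lemma vringX_root x k : (0 < k)%N -> O (x ^+ k) -> O x.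
Proof.
case: k => // k _ Oxk; have [//|OxV] := vring_total P x.
have [->|x0] := eqVneq x 0; first exact: vring0.
have -> : x = x ^+ k.+1 * x^-1 ^+ k by rewrite exprS -mulrA -exprMn divff // expr1n mulr1.
by apply: vringM => //; exact: vringX.
Qed.

Lemma maxidealP z : maxideal P z <-> O z /\ (z = 0 \/ ~ O z^-1).
Proof.
split=> [[Oz nu]|[Oz nu]]; split=> //.
  have [->|z0] := eqVneq z 0; first by left.
  by right=> OzV; apply: nu.
by case=> z0 _ OzV; case: nu => [zE|//]; rewrite zE eqxx in z0.
Qed.

Lemma maxidealV z : z != 0 -> (maxideal P z <-> ~ O z^-1).
Proof.
move=> z0; rewrite maxidealP; split=> [[_ []//]|nO]; first by move/eqP: z0.
by split; [have [//|] := vring_total P z|right].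
Qed.

Lemma vringV z : z != 0 -> (O z <-> ~ maxideal P z^-1).
Proof.
by move=> z0; rewrite maxidealV ?invr_eq0 // invrK; split=> [Oz nO|/contrapT //]; exact: nO.
Qed.

Lemma maxideal0 : maxideal P 0.
Proof. by apply/maxidealP; split; [exact: vring0|left]. Qed.

Lemma maxideal_vring z : maxideal P z -> O z.
Proof. by case. Qed.

Lemma maxidealM x y : O x -> maxideal P y -> maxideal P (x * y).
Proof.
move=> Ox [Oy nuy]; split=> [|[]]; first exact: vringM.
rewrite mulf_eq0 => /norP[x0 y0] _ Oxy; apply: nuy; split=> //.
have -> : y^-1 = x * (x * y)^-1 by rewrite invfM mulrA divff // mul1r.
exact: vringM.
Qed.

Lemma maxidealD x y : maxideal P x -> maxideal P y -> maxideal P (x + y).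
Proof.
move=> Mx My; have [->|x0] := eqVneq x 0; first by rewrite add0r.
have [->|y0] := eqVneq y 0; first by rewrite addr0.
have [O1|O1] := vring_total P (x / y).
  rewrite -[x](divfK y0) -[X in _ + X]mul1r -mulrDl.
  by apply: maxidealM My; apply: vringD O1 vring1.
rewrite invf_div in O1.
rewrite -[y](divfK x0) -[X in X + _]mul1r -mulrDl.
by apply: maxidealM Mx; apply: vringD vring1 O1.
Qed.

Lemma maxideal_sum (I : Type) (r : seq I) (p : pred I) (F : I -> E) :
  (forall i, p i -> maxideal P (F i)) -> maxideal P (\sum_(i <- r | p i) F i).
Proof. by move=> MF; apply: big_ind => //; [exact: maxideal0|exact: maxidealD]. Qed.

Lemma vunit1 : vunit P 1.
Proof. by split; [exact: oner_neq0|exact: vring1|rewrite invr1; exact: vring1]. Qed.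

Lemma vunitM x y : vunit P x -> vunit P y -> vunit P (x * y).
Proof.
move=> [x0 Ox OxV] [y0 Oy OyV]; split; first exact: mulf_neq0.
  exact: vringM.
by rewrite invfM; exact: vringM.
Qed.

Lemma vunitV x : vunit P x -> vunit P x^-1.
Proof. by move=> [x0 Ox OxV]; split; rewrite ?invr_eq0 ?invrK. Qed.

Lemma vunitX x k : vunit P x -> vunit P (x ^+ k).
Proof.
move=> ux; elim: k => [|k IHk]; first by rewrite expr0; exact: vunit1.
by rewrite exprS; exact: vunitM.
Qed.

Lemma vunitXz x (k : int) : vunit P x -> vunit P (x ^ k).
Proof. by case: k => k ux; [|apply: vunitV]; exact: vunitX. Qed.

Lemma vunit_prod (I : Type) (r : seq I) (p : pred I) (F : I -> E) :
  (forall i, p i -> vunit P (F i)) -> vunit P (\prod_(i <- r | p i) F i).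
Proof. by move=> uF; apply: big_ind => //; [exact: vunit1|exact: vunitM]. Qed.

Lemma vunitC a : a != 0 -> vunit P (c a).
Proof.
by move=> a0; split; rewrite ?fmorph_eq0 -?fmorphV //; exact: vringC.
Qed.

Lemma vunit_maxideal u : O u -> (vunit P u <-> ~ maxideal P u).
Proof. by move=> Ou; split=> [uu []//|nM]; apply: contrapT => nu; apply: nM. Qed.

Lemma maxidealN z : maxideal P z -> maxideal P (- z).
Proof.
by move=> Mz; rewrite -mulN1r; apply: maxidealM => //; apply: vringN vring1.
Qed.

Lemma vunitD u z : vunit P u -> maxideal P z -> vunit P (u + z).
Proof.
move=> uu Mz; apply/vunit_maxideal.
  by apply: vringD; [case: uu|exact: maxideal_vring].
move=> Muz; have : maxideal P u by rewrite -(addrK z u); apply/maxidealD/maxidealN.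
by case.
Qed.

End ValuationRing.

Lemma eq_vring (K E : fieldType) (c : {rmorphism K -> E}) (P R : place c) :
  vring P `<=` vring R -> vring R `<=` vring P -> P = R.
Proof.
move=> PR RP; have PRE : vring P = vring R by apply/seteqP.
case: P R PRE {PR RP} => [O s1 c1 p1 t1] [O' s2 c2 p2 t2] /= OO'; subst O'.
congr Place; exact: Prop_irrelevance.
Qed.

Section DiscreteValuation.
Variables (K E : fieldType) (c : {rmorphism K -> E}) (P : place c).

(** Stronger than [uniformizer]: a principal maximal ideal does not by itself make every nonzero
    element a power of its generator times a unit, as valuations of rank 2 show. *)
Definition discrete_at (t : E) : Prop :=
  [/\ t != 0, maxideal P t &
      forall z, z != 0 -> exists k : int, exists2 u, vunit P u & z = t ^ k * u].

Lemma uniformizer_neq0 t : uniformizer P t -> t != 0.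
Proof.
move=> Ut; apply/eqP => t0; case: (vring_proper P) => _; apply => z _.
have [->|z0] := eqVneq z 0; first exact: vring0.
apply/vringV => //; rewrite Ut => -[w _ /eqP]; rewrite t0 mul0r eq_sym invr_eq0.
by apply/negP.
Qed.

Lemma uniformizer_maxideal t : uniformizer P t -> maxideal P t.
Proof. by move=> ->; exists 1; [exact: vring1|rewrite mulr1]. Qed.

Lemma maxideal_uniformizer_power t (k : int) u :
  t != 0 -> maxideal P t -> vunit P u -> (maxideal P (t ^ k * u) <-> 0 < k).
Proof.
move=> t0 Mt uu; have [k0 uk OuV] := uu; split=> [|]; last first.
  case: k => // -[//|k] _; rewrite mulrC -exprnP exprSr mulrA; apply: maxidealM => //.
  by apply: vringM => //; apply/vringX/maxideal_vring.
move=> /maxidealP[_ Mk]; rewrite ltNge; apply/negP => k_le0.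
have [N kN] : exists N : nat, k = - N%:Z by exists `|k|%N; lia.
case: Mk => [/eqP|]; first by rewrite mulf_eq0 expfz_eq0 (negPf t0) andbF (negPf k0).
apply; rewrite invfM invr_expz kN opprK; apply: vringM => //.
exact/vringX/maxideal_vring.
Qed.

Lemma maxideal_power_unit t (k : int) u w :
  t != 0 -> maxideal P t -> vunit P u -> vunit P w -> t ^ k * u = w -> k = 0.
Proof.
move=> t0 Mt uu uw Ew; have [k_gt0|k_le0] := ltrP 0 k.
  by have := (maxideal_uniformizer_power k t0 Mt uu).2 k_gt0; rewrite Ew => -[].
have [k_lt0|] := ltrP k 0; last by lia.
have k'_gt0 : 0 < - k by lia.
have := (maxideal_uniformizer_power (- k) t0 Mt (vunitV uu)).2 k'_gt0.
by rewrite -invr_expz -invfM Ew => -[_ []]; exact: vunitV.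
Qed.

(** Two uniformizers differ by a unit, and a nonzero power of a uniformizer is never a unit, so the
    choice made in [nu] does not matter. *)
Lemma nu_uniformizer t (k : int) u :
  uniformizer P t -> vunit P u -> nu P (t ^ k * u) = k.
Proof.
move=> Ut uu; rewrite /nu; case: xgetP => [k' _ [t' [u' [Ut' uu' Ek]]]|]; last first.
  by move=> /(_ k)[]; exists t, u.
have t0 := uniformizer_neq0 Ut; have t'0 := uniformizer_neq0 Ut'.
have := uniformizer_maxideal Ut; rewrite Ut' => -[w Ow Et].
have := uniformizer_maxideal Ut'; rewrite Ut => -[w' Ow' Et'].
have ww' : w * w' = 1 by apply: (mulfI t'0); rewrite mulrA Et Et' mulr1.
have w0 : w != 0 by apply: contra_eq_neq ww' => ->; rewrite mul0r eq_sym oner_neq0.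
have uw : vunit P w.
  by split=> //; have -> : w^-1 = w' by apply: (mulfI w0); rewrite divff.
have : t' ^ (k' - k) * u' = w ^ k * u.
  apply: (mulfI (expfz_neq0 k t'0)); rewrite mulrA -expfzDr // [k + _]addrC subrK.
  by rewrite -Ek mulrA -expfzMl Et.
move/maxideal_power_unit => /(_ t'0 (uniformizer_maxideal Ut') uu').
by move=> /(_ (vunitM (vunitXz k uw) uu)); lia.
Qed.

Lemma discrete_at_uniformizer t : discrete_at t -> uniformizer P t.
Proof.
move=> [t0 Mt dec]; apply/seteqP; split=> z; last first.
  by move=> [w Ow <-]; rewrite mulrC; exact: maxidealM.
have [->|z0 Mz] := eqVneq z 0; first by exists 0; [exact: vring0|rewrite mulr0].
have [k [u uu zE]] := dec z z0; move: Mz; rewrite zE => /(maxideal_uniformizer_power _ t0 Mt uu).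
case: k {zE} => // -[//|k] _; exists (t ^+ k * u); last by rewrite mulrA -exprS.
by apply: vringM; [exact/vringX/maxideal_vring|case: uu].
Qed.

Definition discrete : Prop := exists t, discrete_at t.

Lemma nu_discrete_at t z : discrete_at t -> z != 0 ->
  exists2 u, vunit P u & z = t ^ nu P z * u.
Proof.
move=> dt z0; have [_ _ /(_ z z0)[k [u uu zE]]] := dt; exists u => //.
by rewrite {2}zE nu_uniformizer //; exact: discrete_at_uniformizer.
Qed.

(** If no decomposition exists, the default value 0 of [nu] is already the right one. Hence a
    nonzero value of [nu] excludes units at any place, known to be discrete or not. *)
Lemma vunit_nu z : vunit P z -> nu P z = 0.
Proof.
move=> uz; rewrite /nu; case: xgetP => // k -> [t [u [Ut uu zE]]].
apply: (maxideal_power_unit _ (uniformizer_maxideal Ut) uu uz); last by rewrite -zE.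
exact: uniformizer_neq0.
Qed.

Section Nu.
Hypothesis dP : discrete.

Lemma nuM z w : z != 0 -> w != 0 -> nu P (z * w) = nu P z + nu P w.
Proof.
move=> z0 w0; have [t dt] := dP; have [t0 Mt _] := dt.
have [u uu {1}->] := nu_discrete_at dt z0.
have [v uv {1}->] := nu_discrete_at dt w0.
rewrite mulrACA -expfzDr // nu_uniformizer //; last exact: vunitM.
exact: discrete_at_uniformizer.
Qed.

Lemma nu1 : nu P 1 = 0. Proof. exact/vunit_nu/vunit1. Qed.

Lemma nuV z : nu P z^-1 = - nu P z.
Proof.
have [->|z0] := eqVneq z 0; last first.
  by have := nu1; rewrite -{1}(mulVf z0) nuM ?invr_eq0 //; lia.
rewrite invr0; suff -> : nu P 0 = 0 by rewrite oppr0.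
rewrite /nu; case: xgetP => // k _ [t [u [/uniformizer_neq0 t0 [u0 _ _] /eqP]]].
by rewrite eq_sym mulf_eq0 expfz_eq0 (negPf t0) andbF (negPf u0).
Qed.

Lemma nuXn z k : z != 0 -> nu P (z ^+ k) = k%:Z * nu P z.
Proof.
move=> z0; elim: k => [|k IHk]; first by rewrite expr0 nu1 mul0r.
by rewrite exprS nuM ?expf_neq0 // IHk; lia.
Qed.

Lemma nuXz z (k : int) : z != 0 -> nu P (z ^ k) = k * nu P z.
Proof.
move=> z0; case: k => k; first by rewrite -exprnP nuXn.
by rewrite NegzE -invr_expz nuV -exprnP nuXn // mulNr.
Qed.

Lemma nu_prod (I : Type) (r : seq I) (p : pred I) (F : I -> E) :
  (forall i, F i != 0) ->
  nu P (\prod_(i <- r | p i) F i) = \sum_(i <- r | p i) nu P (F i).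
Proof.
move=> F0; suff [] : \prod_(i <- r | p i) F i != 0 /\
    nu P (\prod_(i <- r | p i) F i) = \sum_(i <- r | p i) nu P (F i) by [].
elim/big_rec2: _ => [|i y1 y2 _ [y2_0 nu2]]; first by rewrite oner_neq0 nu1.
by rewrite mulf_neq0 // nuM // nu2.
Qed.

Lemma maxideal_nu z : z != 0 -> (maxideal P z <-> 0 < nu P z).
Proof.
move=> z0; have [t dt] := dP; have [t0 Mt _] := dt.
have [u uu {1}->] := nu_discrete_at dt z0.
exact: maxideal_uniformizer_power.
Qed.

Lemma vring_nu z : z != 0 -> (vring P z <-> 0 <= nu P z).
Proof.
move=> z0; rewrite vringV // maxideal_nu ?invr_eq0 // nuV oppr_gt0 leNgt.
by split=> [/negP|/negP].
Qed.

Lemma nu_vunit z : z != 0 -> (vunit P z <-> nu P z = 0).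
Proof.
move=> z0; split=> [|nz]; first exact: vunit_nu.
by split=> //; apply/vring_nu; rewrite ?invr_eq0 ?nuV ?nz.
Qed.

(** Divide by the term of least valuation: the sum becomes 1 plus elements of the maximal ideal, a
    unit. *)
Lemma nu_sum_distinct (I : finType) (z : I -> E) :
  (forall i j, z i != 0 -> z j != 0 -> i != j -> nu P (z i) != nu P (z j)) ->
  (exists i, z i != 0) ->
  exists i, [/\ z i != 0, \sum_j z j != 0, nu P (\sum_j z j) = nu P (z i) &
              forall j, z j != 0 -> nu P (z i) <= nu P (z j)].
Proof.
move=> dist [i0 zi0].
have [i zi mini] := arg_minP (fun i => nu P (z i)) (zi0 : [pred i | z i != 0] i0).
exists i; suff uS : vunit P (\sum_j z j / z i).
  have {1 2}-> : \sum_j z j = z i * \sum_j z j / z i.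
    by rewrite -mulr_suml mulrCA divff // mulr1.
  have [S0 _ _] := uS; rewrite mulf_neq0 // nuM // (vunit_nu uS) addr0.
  by split=> // j zj; exact: mini.
rewrite (bigD1 i) //= divff //; apply: vunitD; first exact: vunit1.
apply: maxideal_sum => j ji; have [->|zj] := eqVneq (z j) 0.
  by rewrite mul0r; exact: maxideal0.
apply/maxideal_nu; first by rewrite mulf_neq0 ?invr_eq0.
rewrite nuM ?invr_eq0 // nuV subr_gt0 lt_neqAle mini // andbT.
by apply: dist => //; rewrite eq_sym.
Qed.

End Nu.
End DiscreteValuation.

(** * Places of a finite extension *)

Lemma scale1_eq0 (k : fieldType) (A : fieldExtType k) (a : k) : (a%:A == 0 :> A) = (a == 0).
Proof. by rewrite scaler_eq0 oner_eq0 orbF. Qed.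

Section LiesOver.
Variables (K E : fieldType) (c : {rmorphism K -> E}) (F : fieldExtType E).
Variables (P : place c) (Q : place (in_alg F \o c)).
Hypothesis QP : forall z, maxideal P z <-> maxideal Q z%:A.

Lemma vring_lies_over z : vring Q z%:A <-> vring P z.
Proof.
have [->|z0] := eqVneq z 0; first by rewrite scale0r; split=> _; exact: vring0.
have z0A : z%:A != 0 :> F by rewrite scale1_eq0.
rewrite !vringV // -(fmorphV (in_alg F)) /=.
by split=> nM Mz; apply: nM; apply/QP.
Qed.

Lemma vunit_lies_over z : vunit P z -> vunit Q z%:A.
Proof.
move=> [z0 Oz OzV]; split; first by rewrite scale1_eq0.
  exact/vring_lies_over.
by rewrite -(fmorphV (in_alg F)) /=; apply/vring_lies_over.
Qed.

Lemma vring_common_denominator (s : seq E) :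
  exists2 a, a != 0 & forall z, z \in s -> vring P (a * z).
Proof.
elim: s => [|x s [a a0 Oas]]; first by exists 1; rewrite ?oner_neq0.
have [Oax|OaxV] := vring_total P (a * x).
  by exists a => // z; rewrite inE => /orP[/eqP->|/Oas].
have [x0|x0] := eqVneq x 0.
  by exists a => // z; rewrite inE => /orP[/eqP->|/Oas//]; rewrite x0 mulr0; exact: vring0.
exists x^-1; rewrite ?invr_eq0 // => z; rewrite inE => /orP[/eqP->|/Oas Oaz].
  by rewrite mulVf //; exact: vring1.
suff <- : (a * x)^-1 * (a * z) = x^-1 * z by apply: vringM.
by rewrite invfM mulrA [_^-1 * _^-1]mulrC -[x^-1 * _ * a]mulrA mulVf // mulr1.
Qed.

(* Since 1/z is a polynomial in z over the rational function field, z divides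
   a nonzero element of that field; this bounds the powers of a uniformizer
   dividing z. *)
Lemma vring_denominator z : z != 0 -> vring Q z ->
  exists2 a, a != 0 & vring Q (a%:A / z).
Proof.
move=> z0 Oz.
have /Fadjoin1_polyP[p zV] : z^-1 \in <<1; z>>%VS by rewrite rpredV memv_adjoin.
have [a a0 Oap] := vring_common_denominator p.
exists a => //; rewrite zV horner_coef mulr_sumr; apply: vring_sum => i _.
rewrite coef_map mulrA; apply: vringM; last exact: vringX.
rewrite /= -(rmorphM (in_alg F)); apply/vring_lies_over.
have [lt_ip|le_pi] := ltnP i (size p); first exact/Oap/mem_nth.
by rewrite nth_default // mulr0; exact: vring0.
Qed.

(** Without a uniformizer [nu Q] would be constantly 0; its value e > 0 at a uniformizer of P
    therefore yields one for Q. Every z is then a power of it times a unit, because only boundedly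
    many powers divide z. *)
Lemma discrete_lies_over e : (0 < e)%N ->
  discrete P ->
  (forall z, z != 0 -> nu Q z%:A = e%:Z * nu P z) -> discrete Q.
Proof.
move=> e_gt0 [t' dt'] ram; have [t'0 Mt' _] := dt'.
have nu_t' : nu P t' = 1.
  by rewrite -[t' in nu P t']mulr1 (nu_uniformizer 1) //;
    [exact: discrete_at_uniformizer|exact: vunit1].
have := ram t' t'0; rewrite nu_t' mulr1 /nu.
case: xgetP => [_ -> [t [u [Ut uu t'E]]] ke|_ e0]; last by move: e_gt0; rewrite -ltz_nat -e0.
rewrite {}ke in t'E; have t0 := uniformizer_neq0 Ut; have Mt := uniformizer_maxideal Ut.
exists t; split=> //.
suff dec z : z != 0 -> vring Q z -> exists N : nat, exists2 u, vunit Q u & z = t ^+ N * u.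
  move=> z z0; have [Oz|OzV] := vring_total Q z.
    by have [N [v uv zE]] := dec z z0 Oz; exists N%:Z; exists v.
  have [||N [v uv zE]] := dec z^-1; rewrite ?invr_eq0 //.
  exists (- N%:Z); exists v^-1; first exact: vunitV.
  by rewrite -[z]invrK zE invfM -invr_expz.
move=> z0 Oz; have [a a0 Oaz] := vring_denominator z0 Oz.
have [v uv aE] := nu_discrete_at dt' a0.
(* The integral z divides a = t^k w with w a unit, so t^N cannot divide z for N > |k|. *)
pose k := e%:Z * nu P a; pose w := u ^ nu P a * v%:A.
have uw : vunit Q w by apply: vunitM; [exact: vunitXz|exact: vunit_lies_over].
have aA : a%:A = t ^ k * w.
  rewrite {1}aE -[_%:A]/(in_alg F _) rmorphM fmorphXz /= t'E expfzMl -mulrA.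
  by rewrite exprz_exp.
pose p N := `[< vring Q (z / t ^+ N) >].
have p0 : exists N, p N by exists 0%N; apply/asboolP; rewrite expr0 divr1.
have p_bound N : p N -> (N <= `|k|)%N.
  move=> /asboolP OzN; rewrite leqNgt; apply/negP => kN.
  have [w0 Ow OwV] := uw.
  have : maxideal Q 1; last by case=> _ []; exact: vunit1.
  have -> : 1 = (a%:A / z * (z / t ^+ N) * w^-1) * (t ^ (N%:Z - k) * 1).
    rewrite mulr1 [_ / z * _]mulrA divfK // aA expfzDr // -invr_expz -exprnP.
    by field; rewrite w0 expfz_neq0 // expf_neq0.
  apply: maxidealM; first by apply: vringM => //; exact: vringM.
  by apply/maxideal_uniformizer_power => //; [exact: vunit1|lia].
(* With N maximal, z / t^N is a unit: otherwise it would be a further multiple of t. *)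
case: (ex_maxnP p0 p_bound) => N /asboolP OzN maxN.
exists N; exists (z / t ^+ N); last by rewrite mulrC divfK // expf_neq0.
apply/vunit_maxideal => //; rewrite Ut => -[b Ob zE].
suff /maxN : p N.+1 by rewrite ltnn.
by apply/asboolP; rewrite exprSr invfM mulrA -zE mulrC mulrA mulVf // mul1r.
Qed.

End LiesOver.

Section Ramified.
Variables (K E : fieldType) (c : {rmorphism K -> E}) (F : fieldExtType E).
Variables (P : place c) (Q : place (in_alg F \o c)).
Hypothesis QP : forall z, maxideal P z <-> maxideal Q z%:A.
Local Notation D := (\dim {:F}).
Hypothesis ram : forall z, z != 0 -> nu Q z%:A = D%:Z * nu P z.
Hypotheses (dP : discrete P) (dQ : discrete Q).

Section Independence.
Variables (I : finType) (g : I -> F).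
Hypothesis g0 : forall i, g i != 0.
Hypothesis g_dist : forall i j (k : int), nu Q (g i) = nu Q (g j) + D%:Z * k -> i = j.

Lemma nu_scale a i : a != 0 -> nu Q (a *: g i) = D%:Z * nu P a + nu Q (g i).
Proof.
by move=> a0; rewrite -mulr_algl nuM ?scale1_eq0 // ram.
Qed.

Lemma nu_sum_scale (a : I -> E) : (exists i, a i != 0) ->
  exists i, [/\ a i != 0, \sum_j a j *: g j != 0,
    nu Q (\sum_j a j *: g j) = D%:Z * nu P (a i) + nu Q (g i) &
    forall j, a j != 0 ->
      D%:Z * nu P (a i) + nu Q (g i) <= D%:Z * nu P (a j) + nu Q (g j)].
Proof.
move=> [i0 ai0].
have az i : (a i *: g i != 0) = (a i != 0) by rewrite scaler_eq0 (negPf (g0 i)) orbF.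
have [|| i [zi S0 nuS mini]] := @nu_sum_distinct _ _ _ _ dQ I (fun i => a i *: g i).
- move=> i j; rewrite !az => ai aj; apply: contra => /eqP; rewrite !nu_scale // => Eij.
  by apply/eqP/(@g_dist i j (nu P (a j) - nu P (a i))); rewrite mulrBr; lia.
- by exists i0; rewrite az.
rewrite az in zi; exists i; rewrite nuS nu_scale //; split=> // j aj.
by rewrite -!nu_scale //; apply: mini; rewrite az.
Qed.

Lemma sum_scale_eq0 (a : I -> E) :
  \sum_j a j *: g j = 0 -> forall i, a i = 0.
Proof.
move=> S0 i; apply/eqP/negPn/negP => ai.
by have [|? [_]] := nu_sum_scale (a := a); [exists i|rewrite S0 eqxx].
Qed.

End Independence.

(** Valuations distinct modulo the ramification index make the g_i independent, and there are as
    many as the degree. The equation [dimF] admits families indexed by 'I_m once the degree is known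
    to be m. *)
Lemma ramified_expansion (d : nat) (dimF : D = d) (g : 'I_d -> F)
    (g0 : forall i, g i != 0)
    (g_dist : forall i j (k : int), nu Q (g i) = nu Q (g j) + D%:Z * k -> i = j) z :
  exists a, z = \sum_i a i *: g i.
Proof.
subst d; pose X := [tuple g i | i < D].
have Xi (i : 'I_D) : X`_i = g i by rewrite -tnth_nth tnth_mktuple.
have freeX : free X.
  apply/freeP => a Sa i; apply: (sum_scale_eq0 g0 g_dist).
  by rewrite -[RHS]Sa; apply: eq_bigr => j _; rewrite Xi.
have /coord_basis/(_ (memvf z)) zE : basis_of fullv X.
  by rewrite basisEfree freeX subvf size_tuple leqnn.
by exists (fun i => coord X i z); rewrite {1}zE; apply: eq_bigr => i _; rewrite Xi.
Qed.

End Ramified.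

(** * Totally ramified radical extensions *)

Lemma residue_inj (d i j : nat) (k : int) :
  (i < d)%N -> (j < d)%N -> i%:Z = j%:Z + d%:Z * k -> i = j.
Proof.
move=> lt_i lt_j Eij; suff k0 : k = 0 by rewrite k0 in Eij; lia.
have [k1|[//|k1]] : k <= -1 \/ k = 0 \/ 1 <= k by lia.
  nia.
nia.
Qed.

Section RadicalRamification.
Variables (K E : fieldType) (c : {rmorphism K -> E}) (m : nat) (f : E).
Hypotheses (m_gt0 : (0 < m)%N) (m_neq0 : m%:R != 0 :> K) (f0 : f != 0).
Hypothesis f_not_power : forall d : nat, (d %| m)%N -> (1 < d)%N ->
  forall g : E, g ^+ d <> f.
Variables (F : fieldExtType E) (y : F).
Hypotheses (yP : y ^+ m = f%:A) (y_gen : <<1; y>>%VS = fullv).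

Lemma radical_dim_le : (\dim {:F} <= m)%N.
Proof.
rewrite -y_gen dim_Fadjoin dimv1 muln1 -ltnS -size_minPoly.
pose p : {poly F} := 'X^m - (f%:A)%:P.
have sp : size p = m.+1 by rewrite size_XnsubC.
rewrite -sp; apply: dvdp_leq; first by rewrite -size_poly_eq0 sp.
apply: minPoly_dvdp; first by rewrite rpredB ?rpredX ?polyOverX // polyOverC rpredZ ?rpred1.
by rewrite rootE /p !hornerE yP subrr.
Qed.

Variables (P : place c) (Q : place (in_alg F \o c)).
Hypothesis QP : forall z, maxideal P z <-> maxideal Q z%:A.
Local Notation D := (\dim {:F}).
Hypothesis ram : forall z, z != 0 -> nu Q z%:A = D%:Z * nu P z.
Hypotheses (dP : discrete P) (dQ : discrete Q).

Let y0 : y != 0.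
Proof.
by apply: contra_neq f0 => y0; apply/eqP; rewrite -(scale1_eq0 F) -yP y0 expr0n gtn_eqF.
Qed.

Let nu_y : m%:Z * nu Q y = D%:Z * nu P f.
Proof. by rewrite -nuXn // yP ram. Qed.

(* If w is integral at Q and w^g lies in the rational function field, then
   write w = b + r, where b is rational and the valuation of r is not a
   multiple of the ramification index: w^g - b^g = g b^(g-1) r + ... forces
   r = 0. *)
Lemma unramified_root_rational (g : nat) (w : F) u : (0 < g)%N -> g%:R != 0 :> K ->
  w ^+ g = u%:A -> u != 0 -> nu P u = 0 -> exists b, w = b%:A.
Proof.
move=> g_gt0 g0 wg u0 nu_u; have [t dt] := dQ; have [t0 Mt _] := dt.
have nu_t j : nu Q (t ^+ j) = j%:Z.
  by rewrite -[t ^+ j]mulr1 (nu_uniformizer j) //;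
    [exact: discrete_at_uniformizer|exact: vunit1].
have w0 : w != 0.
  by apply: contra_neq u0 => w0; apply/eqP; rewrite -(scale1_eq0 F) -wg w0 expr0n gtn_eqF.
have nu_w : nu Q w = 0.
  have : g%:Z * nu Q w = 0 by rewrite -nuXn // wg ram // nu_u mulr0.
  by move/eqP; rewrite mulf_eq0 => /orP[/eqP|/eqP//]; lia.
have D_gt0 : (0 < D)%N by rewrite adim_gt0.
(* The exponents 0, ..., D - 1 represent all valuations modulo D, so these powers form a basis. *)
pose tj (j : 'I_D) := t ^+ j.
have tj0 j : tj j != 0 by rewrite expf_neq0.
have tj_dist (i j : 'I_D) (k : int) : nu Q (tj i) = nu Q (tj j) + D%:Z * k -> i = j.
  by rewrite !nu_t => Eij; apply/val_inj/(residue_inj (ltn_ord i) (ltn_ord j) Eij).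
have [b wE] := ramified_expansion ram dQ erefl tj0 tj_dist w.
have b_neq0 : exists i, b i != 0.
  apply: contrapT => b0; move/eqP: w0; apply; rewrite wE big1 // => i _.
  by have [->|bi] := eqVneq (b i) 0; [rewrite scale0r|case: b0; exists i].
have [o o0] : exists o : 'I_D, o = 0%N :> nat by exists (Ordinal D_gt0).
have [i [bi _ nuS mini]] := nu_sum_scale ram dQ tj0 tj_dist b_neq0.
rewrite -wE nu_w nu_t in nuS.
have io : i = o.
  by apply/val_inj/(@residue_inj D _ _ (- nu P (b i))); rewrite //= o0; lia.
subst i; have nu_bo : nu P (b o) = 0 by move: nuS; rewrite o0; nia.
pose b' j := if j == o then 0 else b j.
pose r := \sum_j b' j *: tj j.
have wr : w = (b o)%:A + r.
  rewrite wE (bigD1 o) // {1}/tj o0 expr0; congr (_ + _).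
  rewrite /r [RHS](bigD1 o) //= /b' eqxx scale0r add0r.
  by apply: eq_bigr => j /negPf ->.
exists (b o); rewrite wr; apply/eqP; rewrite addrC -subr_eq0 addrK; apply/negPn/negP => r0.
have b'_neq0 : exists j, b' j != 0.
  apply: contrapT => b'0; move/eqP: r0; apply; rewrite /r big1 // => j _.
  by have [->|bj] := eqVneq (b' j) 0; [rewrite scale0r|case: b'0; exists j].
have [j [b'j _ nu_r _]] := nu_sum_scale ram dQ tj0 tj_dist b'_neq0.
rewrite -/r nu_t in nu_r.
have jo : j != o by apply: contraNneq b'j => ->; rewrite /b' eqxx.
have bj : b' j = b j by rewrite /b' (negPf jo).
have j_gt0 : (0 < j)%N.
  by rewrite lt0n; apply: contra jo => /eqP j0; apply/eqP/val_inj; rewrite /= j0 o0.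
rewrite bj in b'j nu_r.
have nu_r_gt0 : 0 < nu Q r.
  have := mini j b'j; rewrite !nu_t nu_bo o0 mulr0 add0r nu_r => h.
  rewrite lt_neqAle h andbT; apply/eqP => j0; move: j_gt0.
  rewrite (@residue_inj D j 0 (- nu P (b j))) // mulrN add0r.
  by apply/eqP; rewrite -addr_eq0 addrC -j0.
have Mr : maxideal Q r by apply/maxideal_nu.
have ub : vunit Q (b o)%:A by apply/(vunit_lies_over QP)/nu_vunit.
have Ow : vring Q w by apply/vring_nu; rewrite ?nu_w.
have Mpow k : maxideal Q (w ^+ k - (b o)%:A ^+ k).
  rewrite subrXX mulrC; apply: maxidealM; last by rewrite wr addrC addKr.
  by apply: vring_sum => l _; apply: vringM; apply: vringX => //; case: ub.
pose S := \sum_(l < g) w ^+ (g.-1 - l) * (b o)%:A ^+ l.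
have uS : vunit Q S.
  have -> : S = in_alg F (c g%:R) * (b o)%:A ^+ g.-1 +
      \sum_(l < g) (w ^+ (g.-1 - l) - (b o)%:A ^+ (g.-1 - l)) * (b o)%:A ^+ l.
    rewrite !rmorph_nat; apply/eqP; rewrite -subr_eq -sumrB; apply/eqP.
    rewrite mulr_natl.
    transitivity (\sum_(l < g) (b o)%:A ^+ g.-1 : F); last by rewrite sumr_const card_ord.
    apply: eq_bigr => l _.
    by rewrite -mulrBl opprB addrC subrK -exprD subnK // -ltnS prednK.
  apply: vunitD; first by apply: vunitM; [exact: vunitC|exact: vunitX].
  apply: maxideal_sum => l _; rewrite mulrC; apply: maxidealM => //.
  by apply: vringX; case: ub.
have Eu : (u - b o ^+ g)%:A = r * S.
  have -> : r = w - (b o)%:A by rewrite wr addrC addKr.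
  by rewrite /S -subrXX wg scalerBl -[X in _ = _ - X]/(in_alg F (b o) ^+ g) -rmorphXn.
have [S0 _ _] := uS.
have ub0 : u - b o ^+ g != 0 by rewrite -(scale1_eq0 F) Eu mulf_neq0.
(* As u - b^g is rational, its valuation at Q is a multiple of D, whereas that of r is congruent to
   j modulo D with 0 < j < D. *)
have := ram ub0; rewrite Eu nuM // (vunit_nu uS) addr0 nu_r => Ej.
move: j_gt0.
by rewrite (@residue_inj D j 0 (nu P (u - b o ^+ g) - nu P (b j))) // mulrBr -Ej; ring.
Qed.

(** For g = gcd(m, l) and a uniformizer p of P, the element y^(m/g) / p^(l/g) has g-th power f /
    p^l, of valuation 0 at P. It is thus rational, which makes f a g-th power and forces g = 1. *)
Lemma radical_coprime : coprime m `|nu P f|.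
Proof.
set l := nu P _; pose g := gcdn m `|l|.
have g_gt0 : (0 < g)%N by rewrite gcdn_gt0 m_gt0.
have gm : (g %| m)%N by exact: dvdn_gcdl.
have [l' lE] : exists l' : int, l = g%:Z * l'.
  have /dvdnP[q ql] : (g %| `|l|)%N by exact: dvdn_gcdr.
  by exists (sgz l * q%:Z); rewrite {1}(intEsg l) ql PoszM; lia.
have [p dp] := dP; have [p0 _ _] := dp.
have nu_p : nu P p = 1.
  by rewrite -[p in nu P p]mulr1 (nu_uniformizer 1) //;
    [exact: discrete_at_uniformizer|exact: vunit1].
have g0 : g%:R != 0 :> K.
  by apply: contra m_neq0 => /eqP g0; rewrite -(divnK gm) natrM g0 mulr0.
pose w := y ^+ (m %/ g) / (p ^ l')%:A.
have pl0 : p ^ l' != 0 by rewrite expfz_neq0.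
have plg : (p ^ l') ^+ g = p ^ l by rewrite lE mulrC -exprz_exp.
have wg : w ^+ g = (f / p ^ l)%:A.
  rewrite /w exprMn -exprM divnK // yP exprVn -[(_)%:A ^+ g]/(in_alg F _ ^+ g) -rmorphXn plg.
  by rewrite -[RHS]/(in_alg F _) rmorphM fmorphV.
have [||b wb] := unramified_root_rational g_gt0 g0 wg.
- by rewrite mulf_neq0 ?invr_eq0 ?expfz_neq0.
- by rewrite nuM ?invr_eq0 ?expfz_neq0 // nuV // nuXz // nu_p mulr1 subrr.
rewrite /coprime -/g eqn_leq g_gt0 andbT leqNgt; apply/negP => g_gt1.
apply: (f_not_power gm g_gt1 (g := b * p ^ l')).
apply: (fmorph_inj (in_alg F)); rewrite [RHS]/= -yP rmorphXn rmorphM /= -wb.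
by rewrite divfK ?scale1_eq0 // -exprM divnK.
Qed.

(** In m nu(y) = D nu(f) the factor nu(f) is prime to m, so m divides D; the equation of y gives D
    <= m. *)
Lemma radical_dim : \dim {:F} = m.
Proof.
apply/eqP; rewrite eqn_leq radical_dim_le dvdn_leq ?adim_gt0 //.
rewrite -(Gauss_dvdl _ radical_coprime).
by apply/dvdnP; exists `|nu Q y|%N; have := nu_y; nia.
Qed.

Lemma nu_radical : nu Q y = nu P f.
Proof. by have := nu_y; rewrite radical_dim => /mulfI; apply; lia. Qed.

End RadicalRamification.

(** * Existence of valuation rings *)

Section Chevalley.
Variable E : fieldType.
Implicit Types (A B : set E) (x y z b : E) (p q : {poly E}).

Definition is_subring A : Prop :=
  [/\ A 1, forall x y, A x -> A y -> A (x - y) & forall x y, A x -> A y -> A (x * y)].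

Section Subring.
Variables (B : set E) (subB : is_subring B).

Lemma subring1 : B 1. Proof. by case: subB. Qed.
Lemma subringB x y : B x -> B y -> B (x - y). Proof. by case: subB => _ + _; apply. Qed.
Lemma subringM x y : B x -> B y -> B (x * y). Proof. by case: subB => _ _; apply. Qed.
Lemma subring0 : B 0. Proof. by rewrite -(subrr 1); apply: subringB subring1 subring1. Qed.
Lemma subringN x : B x -> B (- x).
Proof. by move=> Bx; rewrite -sub0r; apply: subringB subring0 Bx. Qed.
Lemma subringD x y : B x -> B y -> B (x + y).
Proof. by move=> Bx By; rewrite -[y]opprK; apply: subringB Bx (subringN By). Qed.
Lemma subringX x k : B x -> B (x ^+ k).
Proof.
by move=> Bx; elim: k => [|k IHk]; rewrite ?expr0 ?exprS; [exact: subring1|exact: subringM].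
Qed.
Lemma subring_sum (J : Type) (r : seq J) (h : pred J) (G : J -> E) :
  (forall j, h j -> B (G j)) -> B (\sum_(j <- r | h j) G j).
Proof. by move=> BG; apply: big_ind => //; [exact: subring0|exact: subringD]. Qed.

Lemma subring_adjoin z : is_subring [set x | exists2 p : {poly E}, forall i, B p`_i & x = p.[z]].
Proof.
split=> [|_ _ [p Bp ->] [q Bq ->]|_ _ [p Bp ->] [q Bq ->]].
- exists 1; last by rewrite hornerC.
  by move=> i; rewrite coef1; case: eqP => _; [exact: subring1|exact: subring0].
- by exists (p - q); [move=> i; rewrite coefB; exact: subringB|rewrite !hornerE].
- exists (p * q); last by rewrite hornerM.
  by move=> i; rewrite coefM; apply: subring_sum => j _; exact: subringM.
Qed.

End Subring.

Lemma maximal_subring_avoiding A b : is_subring A -> ~ A b ->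
  exists B, [/\ is_subring B, A `<=` B, ~ B b &
    forall B', is_subring B' -> B `<=` B' -> ~ B' b -> B' `<=` B].
Proof.
(* Adjoining A to X inside the predicate makes the empty union, that of the empty chain,
   acceptable. *)
move=> subA nAb; pose good X := is_subring (A `|` X) /\ ~ (A `|` X) b.
have [F goodF totF|X [[subB nBb] maxX]] := @Zorn_bigcup E good.
  have pairF x y : (A `|` \bigcup_(X in F) X) x -> (A `|` \bigcup_(X in F) X) y ->
      exists Z, [/\ is_subring Z, Z `<=` A `|` \bigcup_(X in F) X, Z x & Z y].
    have subF X : F X -> A `|` X `<=` A `|` \bigcup_(X in F) X.
      by move=> FX u [|Xu]; [left|right; exists X].
    move=> [Ax|[X FX Xx]] [Ay|[Y FY Yy]].
    - by exists A; split=> // u; left.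
    - by exists (A `|` Y); split; [case: (goodF Y FY)|exact: subF|left|right].
    - by exists (A `|` X); split; [case: (goodF X FX)|exact: subF|right|left].
    - have [XY|YX] := totF X Y FX FY.
        by exists (A `|` Y); split; [case: (goodF Y FY)|exact: subF|right; exact: XY|right].
      by exists (A `|` X); split; [case: (goodF X FX)|exact: subF|right|right; exact: YX].
  split.
    split; first by left; exact: subring1.
      by move=> x y Ux Uy; have [Z [subZ ZU Zx Zy]] := pairF x y Ux Uy; exact/ZU/(subringB subZ).
    by move=> x y Ux Uy; have [Z [subZ ZU Zx Zy]] := pairF x y Ux Uy; exact/ZU/(subringM subZ).
  by move=> [//|[X FX Xb]]; case: (goodF X FX) => _; apply; right.
exists (A `|` X); split=> // B' subB' BB' nB'b.
apply: contrapT => nB'B; apply: (maxX B').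
  by split=> [u Xu|B'X]; [apply: BB'; right|apply: nB'B => u /B'X; right].
rewrite /good; suff -> : A `|` B' = B' by [].
by apply/seteqP; split=> u; [case=> // Au; apply: BB'; left|right].
Qed.

(** Chevalley's argument: a ring B maximal among those avoiding b is a valuation ring, the ideal
    b^-1 B playing the part of the maximal ideal. *)
Theorem valuation_ring_avoiding A b : is_subring A -> A b^-1 -> ~ A b ->
  exists B, [/\ is_subring B, A `<=` B, ~ B b & forall z, B z \/ B z^-1].
Proof.
move=> subA AbV nAb; have [B [subB AB nBb maxB]] := maximal_subring_avoiding subA nAb.
have BbV : B b^-1 by exact: AB.
have b0 : b != 0 by apply/eqP => b0; apply: nBb; rewrite b0; exact: subring0.
pose I x := B (b * x).
have IB x : I x -> B x.
  by move=> Ix; rewrite -[x](mulKf b0); exact: subringM.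
have IM x y : B x -> I y -> I (x * y).
  by move=> Bx Iy; rewrite /I mulrCA; exact: subringM.
have ID x y : I x -> I y -> I (x + y).
  by move=> Ix Iy; rewrite /I mulrDr; exact: subringD.
have I1 : ~ I 1 by rewrite /I mulr1.
(* Inverting s, congruent to 1 modulo I, cannot bring in b: if b s^k is in B, so is b = b s^k + b (1
   - s^k). Maximality of B then gives s^-1. *)
have invB s : I (1 - s) -> s != 0 /\ B s^-1.
  move=> Is; have s0 : s != 0 by apply/eqP => s0; apply: I1; rewrite s0 subr0 in Is.
  have Bs : B s.
    by rewrite -[s](subKr 1); apply: subringB (subring1 subB) _ => //; exact: IB.
  have Isk k : I (1 - s ^+ k).
    elim: k => [|k IHk]; first by rewrite expr0 subrr /I mulr0; exact: subring0.
    have -> : 1 - s ^+ k.+1 = (1 - s ^+ k) + s ^+ k * (1 - s) by rewrite exprSr; ring.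
    by apply: ID => //; apply: IM => //; exact: subringX.
  split=> //; pose B' := [set x | exists k : nat, B (x * s ^+ k)].
  apply: (maxB B').
  - split; first by exists 0%N; rewrite mulr1; exact: subring1.
      move=> x y [k Bx] [l By]; exists (k + l)%N.
      have -> : (x - y) * s ^+ (k + l) = x * s ^+ k * s ^+ l - y * s ^+ l * s ^+ k.
        by rewrite exprD; ring.
      by apply: subringB => //; apply: subringM => //; exact: subringX.
    move=> x y [k Bx] [l By]; exists (k + l)%N.
    by rewrite exprD mulrACA; exact: subringM.
  - by move=> x Bx; exists 0%N; rewrite mulr1.
  - move=> [k Bbk]; apply: nBb; have -> : b = b * s ^+ k + b * (1 - s ^+ k) by ring.
    by apply: subringD => //; exact: Isk.
  - by exists 1%N; rewrite expr1 mulVf //; exact: subring1.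
(* A relation 1 = p(z) with coefficients in I and degree below n. Relations for z and for z^-1
   cannot coexist: each shortens the other. *)
pose W z n := exists p : {poly E}, [/\ (size p <= n)%N, forall i, I p`_i & p.[z] = 1].
have W_step z n k : z != 0 -> W z n.+1 -> W z^-1 k -> (k <= n.+1)%N -> W z n.
  move=> z0 [p [sp Ip pz]] [q [sq Iq qz]] kn.
  have [s0 BsV] : 1 - q`_0 != 0 /\ B (1 - q`_0)^-1 by apply: invB; rewrite subKr.
  set s := 1 - q`_0 in s0 BsV.
  (* Multiplying 1 = q(1/z) by z^n expresses z^n s through lower powers of z; as s is invertible,
     the top term of p can be eliminated. *)
  have qs : \sum_(i < n) q`_(n - i) * z ^+ i = z ^+ n * s.
    have sq' := leq_trans sq kn; rewrite (horner_coef_wide _ sq') big_ord_recl in qz.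
    rewrite expr0 mulr1 in qz; rewrite /s -[X in X - _]qz addrAC subrr add0r mulr_sumr.
    rewrite [LHS](reindex_inj rev_ord_inj) /=; apply: eq_bigr => i _.
    have lt_in := ltn_ord i; rewrite /bump /= subKn // mulrCA; congr (_ * _).
    have -> : z ^+ n = z ^+ (n - i.+1) * z ^+ i.+1 by rewrite -exprD subnK.
    by rewrite add1n exprVn mulfK // expf_neq0.
  exists (\poly_(i < n) (p`_i + p`_n * s^-1 * q`_(n - i))); split.
  - exact: size_poly.
  - move=> i; rewrite coef_poly; case: ifP => _; last by rewrite /I mulr0; exact: subring0.
    apply: ID => //; apply: IM => //; apply: subringM => //; exact: IB.
  - rewrite horner_poly; under eq_bigr do rewrite mulrDl -mulrA.
    rewrite big_split /= -mulr_sumr qs mulrCA divfK // [_ * p`_n]mulrC.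
    by rewrite -pz (horner_coef_wide _ sp) big_ord_recr.
have W0 z : ~ W z 0%N.
  move=> [p [+ _]]; rewrite leqn0 size_poly_eq0 => /eqP -> /eqP.
  by rewrite horner0 eq_sym oner_eq0.
have noW z n k : z != 0 -> W z n -> W z^-1 k -> False.
  have [N] := ubnP (n + k)%N; elim: N z n k => // N IHN z [|n] [|k] ltN z0 Wn Wk.
  - exact: W0 Wn.
  - exact: W0 Wn.
  - exact: W0 Wk.
  have [le_kn|/ltnW le_nk] := leqP k n.
    by apply: (IHN z n k.+1) => //; exact: (W_step z n k.+1).
  apply: (IHN z n.+1 k) => //; first by rewrite addSnnS.
  by apply: (W_step z^-1 k n.+1) => //; rewrite ?invr_eq0 ?invrK.
(* By maximality b lies in B[z]; dividing that expression by b moves its coefficients into I. *)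
have W_notin z : ~ B z -> exists n, W z n.
  move=> nBz; have : [set x | exists2 p : {poly E}, forall i, B p`_i & x = p.[z]] b.
    apply: contrapT => nb; apply: nBz; apply: maxB (subring_adjoin subB z) _ nb _ _.
      move=> x Bx; exists x%:P; last by rewrite hornerC.
      by move=> i; rewrite coefC; case: eqP => _ //; exact: subring0.
    exists 'X; last by rewrite hornerX.
    by move=> i; rewrite coefX; case: eqP => _; [exact: subring1|exact: subring0].
  move=> [p Bp bE]; exists (size p); exists (b^-1 *: p); split.
  - exact: size_scale_leq.
  - by move=> i; rewrite coefZ /I mulVKf.
  - by rewrite hornerZ -bE mulVf.
exists B; split=> // z; apply: contrapT => /not_orP[nBz nBzV].
have z0 : z != 0 by apply/eqP => z0; apply: nBz; rewrite z0; exact: subring0.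
have [n Wn] := W_notin z nBz; have [k Wk] := W_notin _ nBzV.
exact: (noW z n k).
Qed.

End Chevalley.

Lemma place_of_subring (K E : fieldType) (c : {rmorphism K -> E}) (A : set E) :
  is_subring A -> range c `<` A -> A `<` setT -> (forall z, A z \/ A z^-1) ->
  exists P : place c, vring P = A.
Proof.
move=> [A1 AB AM] cA AT Atot.
have subA : subring_closed (mem A).
  split; first exact: mem_set.
    by move=> x y /set_mem Ax /set_mem Ay; apply/mem_set/AB.
  by move=> x y /set_mem Ax /set_mem Ay; apply/mem_set/AM.
by exists (Place subA cA AT Atot).
Qed.

Lemma place_avoiding (K E : fieldType) (c : {rmorphism K -> E}) (A : set E) (b : E) :
  is_subring A -> range c `<` A -> A b^-1 -> ~ A b ->
  exists2 P : place c, A `<=` vring P & ~ vring P b.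
Proof.
move=> subA [cA nAc] AbV nAb.
have [B [subB AB nBb Btot]] := valuation_ring_avoiding subA AbV nAb.
have [|||P PB] := @place_of_subring _ _ c B subB.
- split=> [x /cA/AB//|Bc]; apply: nAc => x Ax; exact/Bc/AB.
- by split=> // BT; apply/nBb/BT.
- exact: Btot.
by exists P; rewrite PB.
Qed.

(** * Splitting fields *)

Lemma splitting_extension (F : fieldType) (p : {poly F}) : p != 0 ->
  exists (L : fieldType) (iota : {rmorphism F -> L}) (rs : seq L),
    map_poly iota p = iota (lead_coef p) *: \prod_(r <- rs) ('X - r%:P).
Proof.
have [N] := ubnP (size p); elim: N F p => // N IHN F p lt_pN p0.
have [p1|p_gt1] := leqP (size p) 1.
  exists F, idfun, [::]; rewrite big_nil map_poly_id // {1}(size1_polyC p1).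
  by rewrite /lead_coef; move: p1 p0; rewrite -size_poly_gt0; case: (size p) => [|[|]] //;
     rewrite alg_polyC.
(* A nonconstant divisor of least size is irreducible, so a root of it can be adjoined. *)
pose good k := `[< exists q : {poly F}, [/\ size q = k, (1 < size q)%N & q %| p] >].
have good_p : exists k, good k by exists (size p); apply/asboolP; exists p; rewrite dvdpp.
case: (ex_minnP good_p) => k /asboolP[q [<- q_gt1 q_dvd]] min_q.
have q_irr : irreducible_poly q.
  split=> // d d1 d_dvd; rewrite -dvdp_size_eqp //.
  have q0 : q != 0 by rewrite -size_poly_gt0 ltnW.
  rewrite eqn_leq dvdp_leq //=; apply: min_q; apply/asboolP; exists d; split=> //.
    have d0 : d != 0 by apply: contra_neq q0 => d0; apply/eqP; rewrite -dvd0p -d0.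
    by rewrite ltn_neqAle eq_sym d1 size_poly_gt0.
  exact: dvdp_trans d_dvd q_dvd.
have [L1 _ [z qz _]] := irredp_FAdjoin q_irr.
pose iota1 := in_alg L1.
have pz : root (map_poly iota1 p) z.
  by rewrite -dvdp_XsubCl (dvdp_trans _ (_ : map_poly iota1 q %| _)) ?dvdp_XsubCl ?dvdp_map.
have [p' pE] := factor_theorem _ _ pz.
have p'0 : p' != 0.
  by apply: contra_neq p0 => p'0; apply/eqP; rewrite -(map_poly_eq0 iota1) pE p'0 mul0r.
have sp' : (size p' < N)%N.
  have := size_map_poly iota1 p; rewrite pE size_Mmonic ?monicXsubC // size_XsubC addn2 /=.
  by move=> E; rewrite -ltnS (leq_trans _ lt_pN) // -E.
have [L [iota [rs rsE]]] := IHN _ p' sp' p'0.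
exists L, (iota \o iota1 : {rmorphism F -> L}), (iota z :: rs).
have lead_p : iota1 (lead_coef p) = lead_coef p'.
  by have := lead_coef_map iota1 p; rewrite pE lead_coef_Mmonic ?monicXsubC // => ->.
rewrite map_poly_comp pE rmorphM /= rsE rmorphB /= map_polyX map_polyC big_cons.
by rewrite mulrC -scalerAr -lead_p.
Qed.

Lemma primitive_root_extension (F : fieldType) (m : nat) : (0 < m)%N -> m%:R != 0 :> F ->
  exists (L : fieldType) (iota : {rmorphism F -> L}) (z : L), m.-primitive_root z.
Proof.
move=> m_gt0 m0; have sX : size ('X^m - 1 : {poly F}) = m.+1 by rewrite size_XnsubC.
have [|L [iota [rs rsE]]] := splitting_extension (p := 'X^m - 1 : {poly F}).
  by rewrite -size_poly_gt0 sX.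
have lead1 : lead_coef ('X^m - 1 : {poly F}) = 1 by apply/eqP/monicXnsubC.
rewrite lead1 rmorph1 scale1r rmorphB rmorph1 /= map_polyXn in rsE.
have m0L : m%:R != 0 :> L by rewrite -(rmorph_nat iota) fmorph_eq0.
exists L, iota.
have /hasP[z _ pz] : has m.-primitive_root rs.
  apply: has_prim_root => //.
  - apply/allP => r r_rs; rewrite unity_rootE.
    have : root ('X^m - 1) r by rewrite rsE root_prod_XsubC.
    by rewrite rootE !hornerE subr_eq0.
  - by rewrite -separable_prod_XsubC -rsE cyclotomic.separable_Xn_sub_1.
  - have := size_prod_XsubC rs id; rewrite /= -rsE size_XnsubC // => -[->].
    exact: leqnn.
by exists z.
Qed.

(** * Regular functions on a radical extension *)

Section RadicalRegularity.
Variables (K E : fieldType) (c : {rmorphism K -> E}) (m : nat) (f : E).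
Hypotheses (m_gt0 : (0 < m)%N) (m_neq0 : m%:R != 0 :> K) (f0 : f != 0).
Variables (F : fieldExtType E) (y : F).
Hypotheses (yP : y ^+ m = f%:A) (y_gen : <<1; y>>%VS = fullv) (dimF : \dim {:F} = m).

Let y0 : y != 0.
Proof.
by apply: contra_neq f0 => y0; apply/eqP; rewrite -(scale1_eq0 F) -yP y0 expr0n gtn_eqF.
Qed.

Lemma minPoly_radical : minPoly 1 y = 'X^m - (f%:A)%:P.
Proof.
have size_rad : size ('X^m - (f%:A)%:P : {poly F}) = m.+1 by rewrite size_XnsubC.
apply/eqP; rewrite -eqp_monic ?monic_minPoly ?monicXnsubC // -dvdp_size_eqp.
  have := dim_Fadjoin 1 y; rewrite y_gen dimF dimv1 muln1 => dimE.
  by rewrite size_minPoly -dimE size_rad.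
apply: minPoly_dvdp.
  by rewrite rpredB ?rpredX ?polyOverX // polyOverC rpredZ ?rpred1.
by rewrite rootE !hornerE yP subrr.
Qed.

Section Conjugate.
Variables (L : fieldType) (iota : {rmorphism F -> L}) (w : L).
Hypothesis w_root : w ^+ m = 1.
(** [ev' h] is the image of [ev h] under the embedding of F in L sending y to w y. Polynomial
    representatives spare the construction of this embedding; [conjugate_eq] is its
    well-definedness. *)
Let ev (h : {poly E}) := (map_poly (in_alg F) h).[y].
Let ev' (h : {poly E}) := (map_poly (iota \o in_alg F) h).[w * iota y].

Lemma conjugate_eq0 h : ev h = 0 -> ev' h = 0.
Proof.
move=> /rootP hy; have : minPoly 1 y %| map_poly (in_alg F) h.
  by apply: minPoly_dvdp => //; exact: alg_polyOver.
rewrite minPoly_radical => /dvdpP[q hE].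
rewrite /ev' map_poly_comp hE rmorphM rmorphB /= map_polyXn map_polyC hornerM !hornerE.
by rewrite exprMn w_root mul1r -rmorphXn yP subrr mulr0.
Qed.

Lemma conjugate_eq h h' : ev h = ev h' -> ev' h = ev' h'.
Proof.
move=> hh'; apply/eqP; rewrite -subr_eq0 /ev' -hornerN -hornerD -rmorphB.
apply/eqP/conjugate_eq0.
by rewrite /ev rmorphB hornerD hornerN; apply/eqP; rewrite subr_eq0; apply/eqP.
Qed.

Variable (B : set L).
Hypotheses (subB : is_subring B) (B_total : forall z, B z \/ B z^-1).

(** R is the inverse image of B under y -> w y. The element b of E witnesses that R is proper. *)
Lemma conjugate_place (P : place c) b : (forall x, vring P x -> B (iota x%:A)) ->
  ~ B (iota b%:A) -> exists R : place (in_alg F \o c),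
    (forall x, vring P x -> vring R x%:A) /\
    forall h, vring R (ev h) -> B (ev' h).
Proof.
move=> PB nBb; pose V := [set z | exists2 h, z = ev h & B (ev' h)].
have ev1 : ev 1 = 1 by rewrite /ev rmorph1 hornerC.
have ev'1 : ev' 1 = 1 by rewrite /ev' rmorph1 hornerC.
have evC x : ev x%:P = x%:A by rewrite /ev map_polyC hornerC.
have ev'C x : ev' x%:P = iota x%:A by rewrite /ev' map_polyC hornerC.
have evM h h' : ev (h * h') = ev h * ev h' by rewrite /ev rmorphM hornerM.
have ev'M h h' : ev' (h * h') = ev' h * ev' h' by rewrite /ev' rmorphM hornerM.
have evB h h' : ev (h - h') = ev h - ev h' by rewrite /ev rmorphB hornerD hornerN.
have ev'B h h' : ev' (h - h') = ev' h - ev' h' by rewrite /ev' rmorphB hornerD hornerN.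
have subV : is_subring V.
  split=> [|_ _ [h -> Bh] [h' -> Bh']|_ _ [h -> Bh] [h' -> Bh']].
  - by exists 1; rewrite ?ev1 ?ev'1 //; exact: subring1.
  - by exists (h - h'); rewrite ?evB ?ev'B //; exact: subringB.
  - by exists (h * h'); rewrite ?evM ?ev'M //; exact: subringM.
have VC x : vring P x -> V x%:A by move=> Px; exists x%:P; rewrite ?evC ?ev'C //; exact: PB.
have nVb : ~ V b%:A.
  by move=> [h bh Bh]; apply: nBb; rewrite -ev'C (@conjugate_eq _ h) // evC.
have [|||R RV] := @place_of_subring _ _ (in_alg F \o c) V subV.
- split=> [_ [x _ <-]|VcF]; first exact/VC/vringC.
  have [_] := vring_const P; apply=> x /VC /VcF[u _ /= ux]; exists u => //.
  exact: (fmorph_inj (in_alg F)).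
- by split=> // TV; exact/nVb/TV.
- move=> z; have evP z' : exists h, z' = ev h by apply/Fadjoin1_polyP; rewrite y_gen memvf.
  have [h zE] := evP z; have [h' z'E] := evP z^-1.
  have [z0|z0] := eqVneq z 0.
    by left; rewrite z0; exists 0; rewrite ?/ev ?/ev' rmorph0 horner0 //; exact: subring0.
  have hh' : ev' h * ev' h' = 1.
    by rewrite -ev'M -ev'1; apply: conjugate_eq; rewrite evM ev1 -zE -z'E divff.
  have h0 : ev' h != 0 by apply: contra_eq_neq hh' => ->; rewrite mul0r eq_sym oner_eq0.
  have h'E : ev' h' = (ev' h)^-1 by apply: (mulfI h0); rewrite hh' divff.
  by have [Bh|BhV] := B_total (ev' h); [left; exists h|right; exists h'; rewrite ?h'E].
exists R; rewrite RV; split=> // h [h1 hh1 Bh1].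
by rewrite (@conjugate_eq _ h1).
Qed.

End Conjugate.

Lemma prim_root_neq0 (L : fieldType) (z : L) : m.-primitive_root z -> z != 0.
Proof.
move=> pz; apply: contra_eq_neq (prim_expr_order pz) => ->.
by rewrite expr0n gtn_eqF // eq_sym oner_eq0.
Qed.

(** Orthogonality of characters of the group of m-th roots of unity, as a geometric sum. *)
Lemma sum_prim_root_expr (L : fieldType) (z : L) (d e : nat) :
  m.-primitive_root z -> (d < m)%N -> (e < m)%N ->
  \sum_(j < m) (z ^+ d / z ^+ e) ^+ j = (if d == e then m%:R else 0).
Proof.
move=> pz lt_d lt_e; have z0 : z != 0 by exact: prim_root_neq0 pz.
have ze0 : z ^+ e != 0 by rewrite expf_neq0.
case: eqVneq => [->|de].
  rewrite divff // -[in RHS](card_ord m) -sumr_const.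
  by apply: eq_bigr => j _; rewrite expr1n.
have w1 : z ^+ d / z ^+ e - 1 != 0.
  apply: contra de; rewrite subr_eq0 => /eqP E1.
  have : z ^+ d == z ^+ e by rewrite -[z ^+ d](divfK ze0) E1 mul1r.
  by rewrite (eq_prim_root_expr pz) !modn_small.
apply: (mulfI w1); rewrite -subrX1 mulr0 exprMn exprVn -!exprM ![(_ * m)%N]mulnC !exprM.
by rewrite (prim_expr_order pz) !expr1n divr1 subrr.
Qed.

(* The conjugates of z in a field containing the m-th roots of unity are
   integral at a common valuation ring; averaging them against the characters
   of the group of roots of unity isolates each term of z. *)
Lemma regular_radical_term (P : place c) (a : 'I_m -> E) (i : 'I_m) :
  (forall R : place (in_alg F \o c), (forall x, vring P x -> vring R x%:A) ->
     vring R (\sum_j a j *: y ^- j)) ->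
  vring P (a i ^+ m / f ^+ i).
Proof.
set b := a i ^+ m / f ^+ i => z_reg; apply: contrapT => nPb.
have b0 : b != 0 by apply/eqP => b0; apply: nPb; rewrite b0; exact: vring0.
have PbV : vring P b^-1 by case: (vring_total P b).
have mF : m%:R != 0 :> F.
  by rewrite -(rmorph_nat (in_alg F \o c)) fmorph_eq0.
have [L [iota [z pz]]] := primitive_root_extension m_gt0 mF.
pose phi : {rmorphism E -> L} := iota \o in_alg F.
pose A := [set phi x | x in vring P].
have subA : is_subring A.
  split=> [|_ _ [x Px <-] [x' Px' <-]|_ _ [x Px <-] [x' Px' <-]].
  - by exists 1; [exact: vring1|rewrite rmorph1].
  - by exists (x - x'); [exact: vringB|rewrite rmorphB].
  - by exists (x * x'); [exact: vringM|rewrite rmorphM].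
have AbV : A (phi b)^-1 by exists b^-1; rewrite ?fmorphV.
have nAb : ~ A (phi b) by move=> [x Px /fmorph_inj xb]; apply: nPb; rewrite -xb.
have [B [subB AB nBb B_total]] := valuation_ring_avoiding subA AbV nAb.
have PB x : vring P x -> B (iota x%:A) by move=> Px; apply: AB; exists x.
have z0 : z != 0 by exact: prim_root_neq0 pz.
have zm : z ^+ m = 1 := prim_expr_order pz.
have Bz : B z.
  have [//|BzV] := B_total z; have -> : z = z^-1 ^+ m.-1.
    apply: (mulfI (invr_neq0 z0)); rewrite mulVf // -exprS prednK //.
    by rewrite exprVn zm invr1.
  exact: subringX.
(* Conjugation acts on polynomials in y, so y^-j is rewritten as f^-1 y^(m - j); replacing y by z^k
   y then multiplies the j-th term by z^(-jk). *)
pose h := \sum_(j < m) (a j / f) *: 'X^(m - j) : {poly E}.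
have yE (j : 'I_m) : y ^- j = f^-1%:A * y ^+ (m - j).
  have yj0 : y ^+ j != 0 by rewrite expf_neq0.
  apply: (mulIf yj0); rewrite mulVf // -mulrA -exprD subnK; last exact/ltnW/ltn_ord.
  by rewrite yP -[_%:A]/(in_alg F _) -[f%:A]/(in_alg F f) -rmorphM mulVf // rmorph1.
have hE : (map_poly (in_alg F) h).[y] = \sum_j a j *: y ^- j.
  rewrite /h rmorph_sum horner_sum; apply: eq_bigr => j _.
  rewrite /= linearZ /= map_polyXn hornerZ hornerXn yE.
  by rewrite -[RHS]mulr_algl mulrA -[(a j)%:A]/(in_alg F (a j)) -[f^-1%:A]/(in_alg F f^-1) -rmorphM.
have Bconj (k : nat) : B (\sum_(j < m) phi (a j) * iota (y ^- j) * (z ^- j) ^+ k).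
  have wm : (z ^+ k) ^+ m = 1 by rewrite -exprM mulnC exprM zm expr1n.
  have [R [PR RB]] := conjugate_place wm subB B_total PB nBb.
  have := RB h; rewrite hE => /(_ (z_reg R PR)).
  rewrite /h rmorph_sum horner_sum; congr (B _); apply: eq_bigr => j _.
  rewrite /= linearZ /= map_polyXn hornerZ hornerXn yE rmorphM rmorphXn exprMn.
  have -> : z ^+ k ^+ (m - j) = z ^- j ^+ k.
    rewrite -exprM mulnC exprM; congr (_ ^+ k).
    have zj0 : z ^+ j != 0 by rewrite expf_neq0.
    by apply: (mulIf zj0); rewrite mulVf // -exprD subnK ?zm //; exact/ltnW/ltn_ord.
  rewrite -[iota _%:A]/(phi _) rmorphM -[iota _%:A]/(phi _); ring.
have Bterm : B (m%:R * (phi (a i) * iota (y ^- i))).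
  have -> : m%:R * (phi (a i) * iota (y ^- i)) =
      \sum_(k < m) (z ^+ i) ^+ k * \sum_(j < m) phi (a j) * iota (y ^- j) * (z ^- j) ^+ k.
    under eq_bigr do rewrite mulr_sumr.
    rewrite exchange_big /= (bigD1 i) //= [X in _ + X]big1 ?addr0 => [|j ji].
      under eq_bigr do rewrite mulrCA -exprMn.
      by rewrite -mulr_sumr (sum_prim_root_expr pz) // eqxx mulrC.
    under eq_bigr do rewrite mulrCA -exprMn.
    by rewrite -mulr_sumr (sum_prim_root_expr pz) // eq_sym val_eqE (negPf ji) mulr0.
  apply: subring_sum => // k _; apply: subringM => //.
  by apply: subringX => //; exact: subringX.
(* The isolated term carries a factor m, which is an invertible constant, and its m-th power is
   b. *)
apply: nBb; have phim : phi (c m%:R^-1) = m%:R^-1 by rewrite !fmorphV !rmorph_nat.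
have -> : phi b = (phi (c m%:R^-1) * (m%:R * (phi (a i) * iota (y ^- i)))) ^+ m.
  rewrite phim mulrA mulVf ?mul1r; last by rewrite -(rmorph_nat iota) fmorph_eq0.
  rewrite exprMn -rmorphXn -rmorphXn exprVn -exprM mulnC exprM yP /b rmorphM fmorphV.
  by rewrite [in RHS]fmorphV -[f%:A]/(in_alg F f) -rmorphXn.
by apply: subringX => //; apply: subringM => //; apply/PB/vringC.
Qed.

End RadicalRegularity.

(** * Places of the rational function field *)

Section RationalFunctionField.
Variables (K E : fieldType) (phi : {rmorphism {poly K} -> E}).
Hypothesis phi_inj : injective phi.
Hypothesis phi_frac : forall z, exists u v : {poly K}, v != 0 /\ z = phi u / phi v.
Local Notation c := (phi \o polyC).
Local Notation X := (phi 'X).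
Implicit Types (P R : place c) (a b : K) (u v : {poly K}).

(* [Some a] stands for the place x = a and [None] for the place at infinity. *)
Definition centered (o : option K) P : Prop :=
  if o is Some a then maxideal P (phi ('X - a%:P)) else ~ vring P X.

Lemma phi_eq0 u : (phi u == 0) = (u == 0).
Proof. by rewrite -(rmorph0 phi) (inj_eq phi_inj). Qed.

Lemma phi_XsubC_neq0 a : phi ('X - a%:P) != 0.
Proof. by rewrite phi_eq0 polyXsubC_eq0. Qed.

Lemma vring_poly P u : vring P X -> vring P (phi u).
Proof.
move=> PX; elim/poly_ind: u => [|u a IHu]; first by rewrite rmorph0; exact: vring0.
rewrite rmorphD rmorphM; apply: vringD; first exact: vringM.
exact: (vringC P a).
Qed.

Lemma vring_centered a P : centered (Some a) P -> vring P X.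
Proof.
move=> Ma; have -> : X = phi ('X - a%:P) + phi a%:P by rewrite -rmorphD subrK.
by apply: vringD; [exact: maxideal_vring|exact: (vringC P a)].
Qed.

Lemma vunit_centered a P u : centered (Some a) P -> u.[a] != 0 -> vunit P (phi u).
Proof.
move=> Ma ua; have /factor_theorem[q qE] : root (u - (u.[a])%:P) a.
  by rewrite rootE !hornerE subrr.
have -> : u = (u.[a])%:P + q * ('X - a%:P) by rewrite -qE addrC subrK.
rewrite rmorphD; apply: vunitD; first exact: (vunitC P ua).
by rewrite rmorphM; apply: maxidealM => //; exact/vring_poly/(vring_centered Ma).
Qed.

Lemma maxideal_invX P : centered None P -> maxideal P X^-1.
Proof.
move=> PX; apply/maxidealV; last by rewrite invrK.
by rewrite invr_eq0 phi_eq0 polyX_eq0.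
Qed.

Lemma vunit_infty P u : centered None P -> u != 0 -> vunit P (X^-1 ^+ (size u).-1 * phi u).
Proof.
move=> PX u0; have X0 : X != 0 by rewrite phi_eq0 polyX_eq0.
set d := (size u).-1; have su : size u = d.+1 by rewrite prednK // size_poly_gt0.
have -> : X^-1 ^+ d * phi u = phi (lead_coef u)%:P +
    \sum_(i < d) phi (u`_i)%:P * X^-1 ^+ (d - i).
  have uE : u = \sum_(i < d.+1) u`_i *: 'X^i by rewrite -su -poly_def coefK.
  rewrite {1}uE big_ord_recr /= rmorphD mulrDr addrC; congr (_ + _).
    rewrite -mul_polyC rmorphM rmorphXn mulrC exprVn mulfK ?expf_neq0 //.
  rewrite rmorph_sum mulr_sumr; apply: eq_bigr => i _.
  rewrite -mul_polyC rmorphM rmorphXn mulrCA; congr (_ * _).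
  have le_id : (i <= d)%N by exact/ltnW/ltn_ord.
  have -> : X^-1 ^+ d = X^-1 ^+ (d - i) * X^-1 ^+ i by rewrite -exprD subnK.
  by rewrite [X^-1 ^+ i]exprVn divfK // expf_neq0.
apply: vunitD; first by apply: (vunitC P); rewrite lead_coef_eq0.
apply: maxideal_sum => i _; have -> : (d - i)%N = (d - i.+1).+1 by have := ltn_ord i; lia.
rewrite exprSr mulrA; apply: maxidealM; last exact: maxideal_invX.
apply: vringM; first exact: (vringC P).
exact/vringX/maxideal_vring/maxideal_invX.
Qed.

Definition local_parameter (o : option K) : E :=
  if o is Some a then phi ('X - a%:P) else X^-1.

Lemma local_parameter_neq0 o : local_parameter o != 0.
Proof.
case: o => [a|]; first exact: phi_XsubC_neq0.
by rewrite invr_eq0 phi_eq0 polyX_eq0.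
Qed.

Lemma maxideal_local_parameter o P : centered o P -> maxideal P (local_parameter o).
Proof. by by case: o => [a //|]; exact: maxideal_invX. Qed.

(** The decomposition depends on the center alone. Places with a common center thus have the same
    valuation, whence [centered_inj]. *)
Lemma local_decomposition o z : z != 0 ->
  exists (k : int) w, z = local_parameter o ^ k * w /\ forall P, centered o P -> vunit P w.
Proof.
move=> z0; suff polydec u : u != 0 -> exists (k : int) w,
    phi u = local_parameter o ^ k * w /\ forall P, centered o P -> vunit P w.
  have [u [v [v0 zE]]] := phi_frac z.
  have u0 : u != 0 by apply: contra_neq z0 => u0; rewrite zE u0 rmorph0 mul0r.
  have [k [w [uE uw]]] := polydec u u0; have [l [x [vE ux]]] := polydec v v0.
  exists (k - l), (w / x); split=> [|P oP].
    by rewrite zE uE vE invfM mulrACA expfzDr ?local_parameter_neq0 // invr_expz.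
  by apply: vunitM; [exact: uw|exact/vunitV/ux].
move=> u0; case: o => [a|].
  have [k [q]] := multiplicity_XsubC u a; rewrite u0 /= => qa ->.
  exists k%:Z, (phi q); split; first by rewrite rmorphM rmorphXn mulrC.
  by move=> P aP; apply: vunit_centered aP _; rewrite -rootE.
exists (- (size u).-1%:Z), (X^-1 ^+ (size u).-1 * phi u); split=> [|P iP].
  rewrite mulrA /local_parameter -invr_expz mulVf ?mul1r //.
  by rewrite expf_neq0 // invr_eq0 phi_eq0 polyX_eq0.
exact: vunit_infty.
Qed.

Lemma discrete_centered o P : centered o P -> discrete_at P (local_parameter o).
Proof.
move=> oP; split; [exact: local_parameter_neq0|exact: maxideal_local_parameter|].
by move=> z /(local_decomposition o)[k [w [zE uw]]]; exists k, w; first exact: uw.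
Qed.

Lemma discrete_of_centered o P : centered o P -> discrete P.
Proof. by move=> oP; exists (local_parameter o); exact: discrete_centered. Qed.

Lemma nu_local_parameter o P : centered o P -> nu P (local_parameter o) = 1.
Proof.
move=> oP; rewrite -[local_parameter o]mulr1 (nu_uniformizer 1) //; last exact: vunit1.
exact/discrete_at_uniformizer/discrete_centered.
Qed.

Lemma nu_centered_eq o P R z : centered o P -> centered o R -> nu P z = nu R z.
Proof.
move=> oP oR; have [->|z0] := eqVneq z 0.
  have := nuV (discrete_of_centered oP) 0; have := nuV (discrete_of_centered oR) 0.
  by rewrite -[in X in _ -> _ -> X](invr0 E) invr0; lia.
have [k [w [-> uw]]] := local_decomposition o z0.
by rewrite !nu_uniformizer //; try exact: uw; exact/discrete_at_uniformizer/discrete_centered.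
Qed.

Lemma centered_inj o P R : centered o P -> centered o R -> P = R.
Proof.
move=> oP oR; apply: eq_vring => z; have [->|z0] := eqVneq z 0; try by move=> _; exact: vring0.
  by move=> /(vring_nu (discrete_of_centered oP) z0) h;
     apply/(vring_nu (discrete_of_centered oR) z0); rewrite -(nu_centered_eq z oP oR).
by move=> /(vring_nu (discrete_of_centered oR) z0) h;
   apply/(vring_nu (discrete_of_centered oP) z0); rewrite (nu_centered_eq z oP oR).
Qed.

(** What R excludes, 1/(x - a) or x, is excluded by the smaller ring P too, so both have the same
    center. *)
Lemma centered_sub o P R : centered o R -> vring P `<=` vring R -> P = R.
Proof.
move=> oR PR; apply: (@centered_inj o) => //; case: o oR => [a|] oR; last by move=> /PR.
have nPa : ~ vring P (phi ('X - a%:P))^-1.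
  by move=> /PR; apply/maxidealV => //; exact: phi_XsubC_neq0.
by apply/maxidealV => //; exact: phi_XsubC_neq0.
Qed.

Lemma nu_XsubC_centered o P a : centered o P ->
  nu P (phi ('X - a%:P)) = if o is Some b then (a == b)%:Z else -1.
Proof.
case: o => [b|] oP.
  have [->|ab] := eqVneq; first exact: nu_local_parameter oP.
  apply/vunit_nu.
  by apply: vunit_centered oP _; rewrite !hornerE subr_eq0 eq_sym.
have uX : vunit P (X^-1 ^+ 1 * phi ('X - a%:P)).
  by have := vunit_infty oP (negbT (polyXsubC_eq0 a)); rewrite size_XsubC.
have dP := discrete_of_centered oP.
have := vunit_nu uX; rewrite expr1 nuM //; last 2 first.
- by rewrite invr_eq0 phi_eq0 polyX_eq0.
- exact: phi_XsubC_neq0.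
by have := nu_local_parameter oP; rewrite /local_parameter => ->; lia.
Qed.

Lemma nu_poly_infty P u : centered None P -> u != 0 -> nu P (phi u) = - (size u).-1%:Z.
Proof.
move=> oP u0; have dP := discrete_of_centered oP.
have := vunit_nu (vunit_infty oP u0).
have iX0 : X^-1 != 0 by rewrite invr_eq0 phi_eq0 polyX_eq0.
rewrite nuM ?phi_eq0 ?expf_neq0 // nuXn //.
by have := nu_local_parameter oP; rewrite /local_parameter => ->; lia.
Qed.

Lemma exists_infty : exists P, centered None P.
Proof.
have X0 : X != 0 by rewrite phi_eq0 polyX_eq0.
(* This ring is K[1/x], which contains 1/x but not x. *)
pose A := [set z | exists N u, (size u <= N.+1)%N /\ z = phi u / X ^+ N].
have cA : range c `<` A.
  split=> [_ [a _ <-]|Ac].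
    by exists 0%N, a%:P; rewrite expr0 divr1 (leq_trans (size_polyC_leq1 a)).
  have [|a _ aX] := Ac X^-1.
    by exists 1%N, 1; rewrite size_poly1 rmorph1 mul1r.
  have : a%:P * 'X = 1 by apply: phi_inj; rewrite rmorphM rmorph1 -(mulVf X0) -aX.
  move=> /(congr1 (horner^~ 0)); rewrite hornerMX mulr0 -polyC1 hornerC => /eqP.
  by rewrite eq_sym oner_eq0.
have subA : is_subring A.
  split=> [|_ _ [N [u [su ->]]] [M [v [sv ->]]]|_ _ [N [u [su ->]]] [M [v [sv ->]]]].
  - by exists 0%N, 1; rewrite size_poly1 rmorph1 expr0 divr1.
  - exists (N + M)%N, (u * 'X^M - v * 'X^N); split.
      rewrite (leq_trans (size_polyD _ _)) // size_polyN geq_max.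
      apply/andP; split; apply: leq_trans (size_polyMleq _ _) _; rewrite size_polyXn addnS /=.
        by rewrite -addSn leq_add2r.
      by rewrite addnC -addnS leq_add2l.
    by rewrite rmorphB !rmorphM !rmorphXn exprD; field; rewrite !expf_neq0.
  - exists (N + M)%N, (u * v); split; last by rewrite rmorphM exprD invfM mulrACA.
    apply: leq_trans (size_polyMleq _ _) _.
    by rewrite -subn1 leq_subLR add1n -addSn -addnS leq_add.
have [||P AP nPX] := @place_avoiding _ _ c A X subA cA.
- by exists 1%N, 1; rewrite size_poly1 rmorph1 mul1r.
- move=> [N [u [su XE]]]; have : 'X^(N.+1) = u.
    by apply: phi_inj; rewrite rmorphXn exprS {1}XE divfK // expf_neq0.
  by move=> uE; move: su; rewrite -uE size_polyXn ltnn.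
by exists P.
Qed.

Lemma poly_of_regular z : (forall P, vring P X -> vring P z) -> exists u, z = phi u.
Proof.
move=> z_reg; have [->|z0] := eqVneq z 0; first by exists 0; rewrite rmorph0.
have [u [v [cuv v0 zE]]] : exists u v : {poly K}, [/\ coprimep u v, v != 0 & z = phi u / phi v].
  have [u [v [v0 zE]]] := phi_frac z; pose d := gcdp u v.
  have d0 : d != 0 by rewrite gcdp_eq0 negb_and v0 orbT.
  have uE : u = u %/ d * d by rewrite divpK // dvdp_gcdl.
  have vE : v = v %/ d * d by rewrite divpK // dvdp_gcdr.
  exists (u %/ d), (v %/ d); split.
  - by apply: coprimep_div_gcd; rewrite v0 orbT.
  - by apply: contra_neq v0 => h; rewrite vE h mul0r.
  rewrite zE {1}uE {1}vE !rmorphM -mulf_div divff ?mulr1 // phi_eq0 //.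
have u0 : u != 0 by apply: contra_neq z0 => u0; rewrite zE u0 rmorph0 mul0r.
have phu0 : phi u != 0 by rewrite phi_eq0.
have phv0 : phi v != 0 by rewrite phi_eq0.
(* The ring K[x, 1/u] contains x and 1/z = v/u. If it contained z, then v would divide a power of u
   and be constant by coprimality; otherwise some valuation ring above it avoids z, against
   regularity. *)
apply: contrapT => nz; pose A := [set x | exists N w, x = phi w / phi u ^+ N].
have Aphi w : A (phi w) by exists 0%N, w; rewrite expr0 divr1.
have subA : is_subring A.
  split=> [|_ _ [N [w ->]] [M [x ->]]|_ _ [N [w ->]] [M [x ->]]].
  - by rewrite -(rmorph1 phi).
  - exists (N + M)%N, (w * u ^+ M - x * u ^+ N).
    by rewrite rmorphB !rmorphM !rmorphXn exprD; field; rewrite !expf_neq0.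
  - by exists (N + M)%N, (w * x); rewrite rmorphM exprD invfM mulrACA.
have cA : range c `<` A.
  split=> [_ [a _ <-]|Ac]; first exact: Aphi.
  have [a _ /phi_inj/(congr1 (size : {poly K} -> nat))] := Ac X (Aphi 'X).
  by rewrite size_polyX => sa; have := size_polyC_leq1 a; rewrite sa.
have [||P AP nPz] := @place_avoiding _ _ c A z subA cA.
- by exists 1%N, v; rewrite zE invf_div.
- move=> [N [w]]; rewrite zE => /eqP; rewrite eqr_div ?expf_neq0 //.
  rewrite -rmorphXn -!rmorphM (inj_eq phi_inj) -exprS => /eqP uwv.
  have : v %| u ^+ N.+1 by rewrite uwv dvdp_mull.
  have cv : coprimep v (u ^+ N.+1) by rewrite coprimep_sym coprimep_expl.
  move=> vu; have := coprimepP _ _ cv v (dvdpp v) vu.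
  rewrite -size_poly_eq1 => /size_poly1P[a a0 va]; apply: nz; exists (a^-1 *: u).
  rewrite zE va -mul_polyC rmorphM mulrC; congr (_ * _).
  apply: (mulfI (_ : phi a%:P != 0)); first by rewrite phi_eq0 polyC_eq0.
  by rewrite divff ?phi_eq0 ?polyC_eq0 // -rmorphM -polyCM divff // rmorph1.
by apply/nPz/z_reg/AP/Aphi.
Qed.

End RationalFunctionField.

(** * Divisors on the projective line *)

Section RationalDivisors.
Variables (K E : fieldType) (phi : {rmorphism {poly K} -> E}).
Hypothesis phi_inj : injective phi.
Hypothesis phi_frac : forall z, exists u v : {poly K}, v != 0 /\ z = phi u / phi v.
Local Notation c := (phi \o polyC).
Local Notation X := (phi 'X).
Local Notation centered := (@centered K E phi).
Variables (f : {poly K}) (rs : seq K).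
Hypothesis f_split : f = lead_coef f *: \prod_(b <- rs) ('X - b%:P).
Hypothesis f_size : (1 < size f)%N.
Variables (r : nat) (P : 'I_r -> place c).
Hypothesis P_inj : injective P.
Hypothesis P_range : forall R, (exists k, P k = R) <-> nu R (phi f) != 0.

Let f0 : f != 0. Proof. by rewrite -size_poly_gt0 ltnW. Qed.

Lemma split_vunit_or_centered R : vring R X ->
  vunit R (phi f) \/ exists a, centered (Some a) R.
Proof.
move=> RX; have [[a aR]|no_center] := pselect (exists a, centered (Some a) R).
  by right; exists a.
left; rewrite f_split -mul_polyC rmorphM rmorph_prod; apply: vunitM.
  by apply: (vunitC R); rewrite lead_coef_eq0.
apply: vunit_prod => b _; apply/vunit_maxideal; first exact: vring_poly.
by move=> bR; apply: no_center; exists b.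
Qed.

(** Since f splits over K, a place where x is regular and f is not a unit contains some x - b in its
    maximal ideal. *)
Lemma exists_center k : exists o, centered o (P k).
Proof.
have [PX|PX] := pselect (vring (P k) X); last by exists None.
have [uf|[a aP]] := split_vunit_or_centered PX; last by exists (Some a).
by have /P_range := ex_intro (fun k' => P k' = P k) k erefl; rewrite vunit_nu.
Qed.

(** Infinity is always among the P_k, because the nonconstant f has a pole there. *)
Lemma vring_X_outside R : ~ (exists k, P k = R) -> vring R X.
Proof.
move=> nR; apply: contrapT => iR; apply: nR; apply/P_range.
by rewrite (nu_poly_infty phi_inj phi_frac iR f0); lia.
Qed.

Lemma vunit_outside R : ~ (exists k, P k = R) -> vunit R (phi f).
Proof.
move=> nR; have RX := vring_X_outside nR.
have [//|[a aR]] := split_vunit_or_centered RX.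
apply/(nu_vunit (discrete_of_centered phi_inj phi_frac aR)); first by rewrite phi_eq0.
by apply/eqP/negPn/negP => /P_range.
Qed.

Variable o : 'I_r -> option K.
Hypothesis oP : forall k, centered (o k) (P k).

Lemma center_outside R k a : ~ (exists k, P k = R) -> o k = Some a ->
  vunit R (phi ('X - a%:P)).
Proof.
move=> nR ok; have RX := vring_X_outside nR; apply/vunit_maxideal; first exact: vring_poly.
move=> aR; apply: nR; exists k; have := oP k; rewrite ok => aP.
exact: (centered_inj phi_inj phi_frac aP aR).
Qed.

Lemma center_inj : injective o.
Proof.
move=> k l okl; apply: P_inj; have := oP k; rewrite okl => olP.
exact: (centered_inj phi_inj phi_frac olP (oP l)).
Qed.

Lemma exists_center_infty : exists k, o k = None.
Proof.
have [R iR] := exists_infty phi_inj; have [k PkR] : exists k, P k = R.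
  by apply/P_range; rewrite (nu_poly_infty phi_inj phi_frac iR f0); lia.
exists k; case okE : (o k) => [a|//]; have := oP k; rewrite okE PkR => /vring_centered.
by move/iR.
Qed.

Let dP k : discrete (P k) := discrete_of_centered phi_inj phi_frac (oP k).

Let lin k : E := if o k is Some a then phi ('X - a%:P) else 1.

Let lin0 k : lin k != 0.
Proof.
by rewrite /lin; case: (o k) => [a|]; rewrite ?oner_neq0 // phi_XsubC_neq0.
Qed.

Let nu_lin l k : nu (P l) (lin k) =
  if o l is Some _ then (k == l)%:Z * (o k != None)%:Z else - (o k != None)%:Z.
Proof.
rewrite /lin; case okE : (o k) => [a|]; last by rewrite nu1 // mulr0; case: (o l).
rewrite (nu_XsubC_centered phi_inj phi_frac a (oP l)); case olE : (o l) => [b|//].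
rewrite mulr1; congr (_ _)%:Z; apply/eqP/eqP => [ab|kl].
  by apply: center_inj; rewrite okE olE ab.
by rewrite -kl okE in olE; case: olE.
Qed.

(** The exponent at infinity is ignored, [lin] being 1 there: the valuation at infinity is imposed
    by degree 0, which explains the correction in [nu_div]. *)
Let div (e : 'I_r -> int) : E := \prod_k lin k ^ e k.

Let div0 e : div e != 0.
Proof. by apply/prodf_neq0 => k _; rewrite expfz_neq0. Qed.

Let nu_div e l : nu (P l) (div e) = if o l is Some _ then e l else e l - \sum_k e k.
Proof.
rewrite nu_prod // => [|k]; last by rewrite expfz_neq0.
under eq_bigr do rewrite nuXz // nu_lin.
case olE : (o l) => [a|].
  rewrite (bigD1 l) //= eqxx olE !mulr1 big1 ?addr0 // => k kl.
  by rewrite (negPf kl) mul0r mulr0.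
rewrite (bigD1 l) //= olE eqxx oppr0 mulr0 add0r [in RHS](bigD1 l) //= opprD addNKr.
rewrite -sumrN; apply: eq_bigr => k kl; suff -> : o k != None by rewrite mulrN1.
by apply: contra_neq kl => okN; apply: center_inj; rewrite okN olE.
Qed.

Let vunit_div R e : ~ (exists k, P k = R) -> vunit R (div e).
Proof.
move=> nR; apply: vunit_prod => k _; apply: vunitXz; rewrite /lin.
by case okE : (o k) => [a|]; [exact: center_outside okE|exact: vunit1].
Qed.

(** z / [div e] is regular at all finite places, hence a polynomial, and a polynomial has no zero at
    infinity. *)
Theorem degree_bound (z : E) (e : 'I_r -> int) : z != 0 ->
  (forall k, e k <= nu (P k) z) ->
  (forall R, ~ (exists k, P k = R) -> vring R z) -> \sum_k e k <= 0.
Proof.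
move=> z0 ez z_reg; have [|u uE] := poly_of_regular phi_inj phi_frac (z := z / div e).
  move=> R RX; have [[k PkR]|nR] := pselect (exists k, P k = R).
    subst R; apply/(vring_nu (dP k)); first by rewrite mulf_neq0 ?invr_eq0.
    rewrite nuM ?invr_eq0 // nuV // nu_div.
    case okE : (o k) => [a|]; first by rewrite subr_ge0.
    by have := oP k; rewrite okE => /(_ RX).
  apply: vringM; first exact: z_reg.
  by case: (vunitV (vunit_div e nR)).
have [l olE] := exists_center_infty; have iP := oP l; rewrite olE in iP.
have u0 : u != 0 by rewrite -(phi_eq0 phi_inj) -uE mulf_neq0 ?invr_eq0.
have := nu_poly_infty phi_inj phi_frac iP u0.
rewrite -uE nuM ?invr_eq0 // nuV // nu_div olE; have := ez l; lia.
Qed.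

(** [div e] has N = - sum e zeros too many at infinity. If infinity is in S, the factor (x - a0)^N
    moves them to the point a0 outside S; otherwise they may stay. *)
Theorem function_with_divisor (S : {pred 'I_r}) (e : 'I_r -> int) (a0 : K) :
  (forall l, l \in S -> o l = None -> forall k, k \in S -> o k != Some a0) ->
  \sum_k e k <= 0 ->
  exists z, [/\ z != 0, forall k, k \in S -> nu (P k) z = e k,
    forall k, e k <= nu (P k) z &
    forall R, ~ (exists k, P k = R) -> vring R z].
Proof.
move=> a0S e_le0; have [l olE] := exists_center_infty.
have [N NE] : exists N : nat, N%:Z = - \sum_k e k.
  by case: (\sum_k e k) e_le0 => // [[|N]|N] _ //; [exists 0%N|exists N.+1].
pose extra := if l \in S then phi ('X - a0%:P) ^+ N else 1.
have extra0 : extra != 0.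
  by rewrite /extra; case: ifP => _; rewrite ?oner_neq0 // expf_neq0 ?phi_XsubC_neq0.
have X0 := phi_XsubC_neq0 phi_inj a0.
have nu_z k : nu (P k) (div e * extra) = e k + (if o k is Some b then
    (if l \in S then N%:Z * (a0 == b)%:Z else 0) else (if l \in S then 0 else N%:Z)).
  rewrite nuM // nu_div /extra; case okE : (o k) => [b|].
    case: ifP => lS; last by rewrite nu1.
    by rewrite nuXn // (nu_XsubC_centered phi_inj phi_frac a0 (oP k)) okE.
  case: ifP => lS; last by rewrite nu1 // addr0 NE.
  by rewrite nuXn // (nu_XsubC_centered phi_inj phi_frac a0 (oP k)) okE NE; lia.
exists (div e * extra); split.
- exact: mulf_neq0.
- move=> k kS; rewrite nu_z; case okE : (o k) => [b|].
    case: ifP => lS; last by rewrite addr0.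
    have := a0S l lS olE k kS; rewrite okE => ab.
    have -> : (a0 == b) = false by apply: contraNF ab => /eqP ->.
    by rewrite mulr0 addr0.
  have -> : l = k by apply: center_inj; rewrite olE okE.
  by rewrite kS addr0.
- move=> k; rewrite nu_z lerDl; by case: (o k) => [b|]; case: ifP.
- move=> R nR; apply: vringM; first by case: (vunit_div e nR).
  rewrite /extra; case: ifP => _; last exact: vring1.
  exact/vringX/vring_poly/vring_X_outside.
Qed.

End RationalDivisors.

(** * The generalized Weierstrass semigroup *)

(** Infinity is one of the points of S, so at most |K| - 1 elements of K are excluded. *)
Lemma exists_avoided_point (K : finType) (r : nat) (o : 'I_r -> option K) (a : K)
    (S : {set 'I_r}) (l : 'I_r) :
  l \in S -> o l = None -> (#|S| <= #|K|)%N -> exists a0, forall k, k \in S -> o k != Some a0.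
Proof.
move=> lS olN S_le; pose B := [set odflt a (o k) | k in (S :\ l)%SET]%SET.
have lt_B : (#|B| < #|K|)%N.
  apply: leq_ltn_trans (leq_imset_card _ _) _.
  by rewrite (leq_trans _ S_le) // [X in (_ < X)%N](cardsD1 l) lS.
have [a0] : exists a0, a0 \in (~: B)%SET.
  by apply/card_gt0P; rewrite -(ltn_add2l #|B|) addn0 cardsC.
rewrite inE => a0B; exists a0 => k kS; apply: contra a0B => /eqP oka.
apply/imsetP; exists k; last by rewrite oka.
by rewrite !inE kS andbT; apply: contra_eq_neq oka => ->; rewrite olN.
Qed.

Section Restriction.
Variables (K E : fieldType) (c : {rmorphism K -> E}) (F : fieldExtType E).
Variables (R : place (in_alg F \o c)) (x : E).
Hypothesis x_transcendental : forall a, x <> c a /\ x^-1 <> c a.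

(** The restriction is not all of E: each w in F is a polynomial over E in w^-1, so R would be all
    of F. It exceeds the constants because it contains x or 1/x. *)
Lemma exists_restriction :
  exists P : place c, forall z, vring P z <-> vring R z%:A.
Proof.
pose A := [set z | vring R z%:A].
have in_algE z : z%:A = in_alg F z by [].
have subA : is_subring A.
  split=> [|u v|u v]; rewrite /A /=.
  - by rewrite scale1r; exact: vring1.
  - by rewrite scalerBl; exact: vringB.
  - by rewrite !in_algE rmorphM; exact: vringM.
have Atot z : A z \/ A z^-1.
  by rewrite /A /= !in_algE fmorphV; exact: vring_total.
have [||P PA] := @place_of_subring _ _ c A subA _ _ Atot.
- split=> [_ [a _ <-]|Ac]; first exact: (vringC R a).
  by have [/Ac[a _ ca]|/Ac[a _ ca]] := Atot x; have [] := x_transcendental a; rewrite ca.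
- split=> // TA; have [_] := vring_proper R; apply=> w _.
  have [//|RwV] := vring_total R w.
  have [p wE] : exists p, w = (map_poly (in_alg F) p).[w^-1].
    by apply/Fadjoin1_polyP; rewrite -[w in w \in _]invrK rpredV memv_adjoin.
  rewrite wE horner_coef; apply: vring_sum => i _.
  by rewrite coef_map; apply: vringM; [exact: TA|exact: vringX].
by exists P => z; rewrite PA.
Qed.

End Restriction.

Section RadicalSemigroup.
Variables (K : finFieldType) (E : fieldType) (phi : {rmorphism {poly K} -> E}).
Hypothesis phi_inj : injective phi.
Hypothesis phi_frac : forall z, exists u v : {poly K}, v != 0 /\ z = phi u / phi v.
Local Notation c := (phi \o polyC).
Variables (m : nat) (f : {poly K}) (rs : seq K).
Hypotheses (m_gt0 : (0 < m)%N) (m_neq0 : m%:R != 0 :> K).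
Hypothesis f_split : f = lead_coef f *: \prod_(b <- rs) ('X - b%:P).
Hypothesis f_size : (1 < size f)%N.
Hypothesis f_not_power : forall d : nat, (d %| m)%N -> (1 < d)%N ->
  forall g : E, g ^+ d <> phi f.
Variables (F : fieldExtType E) (y : F).
Hypotheses (yP : y ^+ m = (phi f)%:A) (y_gen : <<1; y>>%VS = fullv).
Variables (r n : nat) (P : 'I_r -> place c).
Hypothesis P_inj : injective P.
Hypothesis P_range : forall R, (exists k, P k = R) <-> nu R (phi f) != 0.
Hypotheses (hnr : (n <= r)%N) (n_gt0 : (0 < n)%N) (n_le : (n <= #|K|)%N).
Local Notation w := (widen_ord hnr).
Variable Q : 'I_n -> place (in_alg F \o c).
Hypothesis QP : forall k z, maxideal (P (w k)) z <-> maxideal (Q k) z%:A.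
Hypothesis Q_unique : forall k (R : place (in_alg F \o c)),
  (forall z, maxideal (P (w k)) z <-> maxideal R z%:A) -> R = Q k.
Hypothesis ram : forall k z, z != 0 ->
  nu (Q k) z%:A = (\dim {:F})%:Z * nu (P (w k)) z.

Let lam k := nu (P k) (phi f).
Let fl k (i : nat) : int := ((i%:Z * lam k) %/ m%:Z)%Z.
Let cl k (i : nat) : int := Num.ceil ((i%:Z * lam k)%:~R / m%:R : rat).
Let T (i : 'I_m) (k : 'I_n) : int := ((i%:Z * lam (w k)) %% m%:Z)%Z.
(** Floors at the places below the Q_k, where poles are free and j is measured from the floor;
    ceilings elsewhere, as the least valuation that regularity allows. *)
Let s (i : 'I_m) : int := \sum_(k < n) fl (w k) i + \sum_(k < r | ~~ (k < n)%N) cl k i.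

Let f0 : f != 0. Proof. by rewrite -size_poly_gt0 ltnW. Qed.
Let phif0 : phi f != 0. Proof. by rewrite phi_eq0. Qed.

Let o_exists : exists o, forall k, centered (o k) (P k).
Proof.
by have [o oP] := choice (exists_center f_split f_size P_range); exists o.
Qed.

Let dP k : discrete (P k).
Proof. by have [o oP] := o_exists; exact: (discrete_of_centered phi_inj phi_frac (oP k)). Qed.

Let dQ k : discrete (Q k).
Proof. exact: (discrete_lies_over (QP k) (adim_gt0 _) (dP (w k)) (ram k)). Qed.

Let k0 : 'I_n := Ordinal n_gt0.

Let dimF : \dim {:F} = m.
Proof.
exact: (radical_dim m_gt0 m_neq0 phif0 f_not_power yP y_gen (QP k0) (ram k0) (dP _) (dQ _)).
Qed.

Let y0 : y != 0.
Proof.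
by apply: contra_neq phif0 => y0; apply/eqP; rewrite -(scale1_eq0 F) -yP y0 expr0n gtn_eqF.
Qed.

Let yi0 (i : 'I_m) : y ^- i != 0. Proof. by rewrite invr_eq0 expf_neq0. Qed.

Let nu_yi k (i : 'I_m) : nu (Q k) (y ^- i) = - (i%:Z * lam (w k)).
Proof.
rewrite nuV // nuXn //; congr (- (_ * _)).
exact: (nu_radical m_gt0 m_neq0 phif0 f_not_power yP y_gen (QP k) (ram k) (dP _) (dQ _)).
Qed.

Let lam_inj k (i i' : 'I_m) (d : int) :
  i%:Z * lam (w k) = i'%:Z * lam (w k) + m%:Z * d -> i = i'.
Proof.
move=> Ei; have cop : coprimez m%:Z (lam (w k)).
  exact: (radical_coprime m_gt0 m_neq0 phif0 f_not_power yP (QP k) (ram k) (dP _) (dQ _)).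
have : (m%:Z %| (i%:Z - i'%:Z) * lam (w k))%Z.
  by apply/dvdzP; exists d; rewrite mulrBl Ei; ring.
rewrite Gauss_dvdzl // => /dvdzP[q Eq]; apply: val_inj => /=.
by apply: (residue_inj (ltn_ord i) (ltn_ord i') (k := q)); rewrite mulrC -Eq; ring.
Qed.

Let yi_dist k (i j : 'I_m) (d : int) :
  nu (Q k) (y ^- i) = nu (Q k) (y ^- j) + (\dim {:F})%:Z * d -> i = j.
Proof.
rewrite !nu_yi dimF => Eij; apply: (@lam_inj k i j (- d)).
by rewrite mulrN; lia.
Qed.

Let ceil_le k i (v : int) : (cl k i <= v) = (i%:Z * lam k <= m%:Z * v).
Proof.
have m0 : 0 < m%:R :> rat by rewrite ltr0n.
rewrite /cl Num.Theory.ceil_le_int ler_pdivrMr //.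
by rewrite -[m%:R]/((m%:Z)%:~R) -intrM ler_int [v * _]mulrC.
Qed.

Let T_def k (i : 'I_m) : i%:Z * lam (w k) = m%:Z * fl (w k) i + T i k.
Proof. by rewrite [LHS](divz_eq _ m%:Z) [(_ %/ _)%Z * _]mulrC. Qed.

Lemma radical_class_inj k (i i' : 'I_m) (j j' : int) :
  m%:Z * j + T i k = m%:Z * j' + T i' k -> i = i'.
Proof.
have := T_def k i; have := T_def k i' => Ti' Ti Ej.
apply: (@lam_inj k i i' (fl (w k) i - fl (w k) i' + j' - j)).
by rewrite Ti Ti'; move: Ej; rewrite !(mulrDr, mulrBr, mulrN); lia.
Qed.

Let sum_split (e : 'I_r -> int) :
  \sum_k e k = \sum_(k < n) e (w k) + \sum_(k < r | ~~ (k < n)%N) e k.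
Proof. by rewrite (bigID (fun k : 'I_r => (k < n)%N)) /= (big_ord_narrow hnr). Qed.

(* Away from the places below the Q_k, a y^-i is regular iff its m-th power
   a^m / f^i is. *)
Let admissible (a : E) (i : nat) : Prop :=
  forall R, (forall k : 'I_n, R <> P (w k)) -> vring R (a ^+ m / phi f ^+ i).

Let outer_neq (k : 'I_r) : ~~ (k < n)%N -> forall l : 'I_n, P k <> P (w l).
Proof. by move=> kn l /P_inj kl; move: kn; rewrite kl /= ltn_ord. Qed.

Let nu_term k a i : a != 0 ->
  nu (P k) (a ^+ m / phi f ^+ i) = m%:Z * nu (P k) a - i%:Z * lam k.
Proof.
by move=> a0; rewrite nuM ?invr_eq0 ?expf_neq0 // nuV // !nuXn.
Qed.

(** Admissibility reads nu(a) >= i lambda_k / m at the outer P_k, that is, at least the ceiling; off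
    all P_k, f is a unit and a is regular. The degree bound does the rest. *)
Lemma admissible_degree (a : E) (i : 'I_m) : a != 0 -> admissible a i ->
  s i <= \sum_k (fl (w k) i - nu (P (w k)) a).
Proof.
move=> a0 adm; have [o oP] := o_exists.
pose e (k : 'I_r) := if (k < n)%N then nu (P k) a else cl k i.
have : \sum_k e k <= 0.
  apply: (degree_bound phi_inj phi_frac f_size P_inj P_range oP a0) => [k|R nR].
    rewrite /e; case: ifPn => // kn; rewrite ceil_le -subr_ge0 -nu_term //.
    apply/(vring_nu (dP k)); first by rewrite mulf_neq0 ?invr_eq0 ?expf_neq0.
    exact/adm/outer_neq.
  apply: (vringX_root m_gt0).
  have -> : a ^+ m = (a ^+ m / phi f ^+ i) * phi f ^+ i by rewrite divfK ?expf_neq0.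
  apply: vringM; first by apply: adm => k RP; apply: nR; exists (w k).
  by apply: vringX; case: (vunit_outside phi_inj phi_frac f_split f_size P_range nR).
rewrite sum_split /e sumrB /s.
have -> : \sum_(k < n) (if (w k < n)%N then nu (P (w k)) a else cl (w k) i) =
    \sum_(k < n) nu (P (w k)) a by apply: eq_bigr => k _; rewrite /= ltn_ord.
have -> : \sum_(k < r | ~~ (k < n)%N) (if (k < n)%N then nu (P k) a else cl k i) =
    \sum_(k < r | ~~ (k < n)%N) cl k i by apply: eq_bigr => k /negPf ->.
by rewrite lerD2l -[_ <= - _]subr_le0 opprK addrC.
Qed.

(** Prescribe the wanted value at the inner places and the least admissible one, the ceiling, at the
    outer ones: the degree is s i - sum j <= 0. *)
Lemma admissible_exists (i : 'I_m) (j : 'I_n -> int) : s i <= \sum_k j k ->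
  exists a, [/\ a != 0, admissible a i & forall k, nu (P (w k)) a = fl (w k) i - j k].
Proof.
move=> le_s; have [o oP] := o_exists.
pose S := [set w k | k in 'I_n]%SET.
have Sw k : w k \in S by apply/imsetP; exists k.
pose e (k : 'I_r) := if insub (k : nat) is Some k' then fl k i - j k' else cl k i.
have ew k : e (w k) = fl (w k) i - j k by rewrite /e /= valK.
have eo (k : 'I_r) : ~~ (k < n)%N -> e k = cl k i by move=> kn; rewrite /e insubN.
have [a0 a0S] : exists a0, forall l, l \in S -> o l = None ->
    forall k, k \in S -> o k != Some a0.
  have [[l [lS olN]]|noinf] := pselect (exists l, l \in S /\ o l = None); last first.
    by exists 0 => l lS olN; case: noinf; exists l.
  have [|a0 a0S] := exists_avoided_point 0 lS olN; last by exists a0.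
  by rewrite (leq_trans _ n_le) // (leq_trans (leq_imset_card _ _)) // card_ord.
have [|a [a0' aS e_le a_out]] := function_with_divisor phi_inj phi_frac f_size
    P_inj P_range oP a0S (e := e).
  rewrite sum_split; under eq_bigr do rewrite ew.
  have -> : \sum_(k < r | ~~ (k < n)%N) e k = \sum_(k < r | ~~ (k < n)%N) cl k i.
    by apply: eq_bigr => k /eo.
  by rewrite sumrB addrAC subr_le0.
exists a; split=> // [R nR|k]; last by rewrite aS ?ew.
have [[k PkR]|nR'] := pselect (exists k, P k = R); last first.
  apply: vringM; first exact/vringX/a_out.
  have uf := vunit_outside phi_inj phi_frac f_split f_size P_range nR'.
  by have /vunitV[] := vunitX i uf.
subst R; apply/(vring_nu (dP k)); first by rewrite mulf_neq0 ?invr_eq0 ?expf_neq0.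
rewrite nu_term // subr_ge0 -ceil_le.
have kn : ~~ (k < n)%N.
  by apply/negP => kn; apply: (nR (Ordinal kn)); congr P; exact: val_inj.
by rewrite -eo.
Qed.

(** A place of F whose ring contains R cannot be Q_k: R would then lie in P_k, and hence equal it by
    [centered_sub]. *)
Lemma regular_admissible (a : 'I_m -> E) :
  regular_outside Q (\sum_i a i *: y ^- i) -> forall i, admissible (a i) i.
Proof.
move=> z_reg i R nR.
apply: (regular_radical_term m_gt0 m_neq0 phif0 yP y_gen dimF) => R' RR'.
apply: z_reg => k R'Q; apply: (nR k); have [o oP] := o_exists.
apply: (centered_sub phi_inj phi_frac (oP (w k))) => x Rx.
by apply/(vring_lies_over (QP k)); rewrite -R'Q; exact: RR'.
Qed.

(** A place other than the Q_k restricts to none of the inner P_k, since Q_k is the only place above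
    P_k; the m-th power of the term is rational. *)
Lemma admissible_regular a (i : 'I_m) : admissible a i -> regular_outside Q (a *: y ^- i).
Proof.
move=> adm R nR.
have [R' R'R] : exists R' : place c, forall z, vring R' z <-> vring R z%:A.
  apply: (@exists_restriction _ _ _ _ R (phi 'X)) => b; split=> [/phi_inj|bX].
    by move=> /(congr1 (size : {poly K} -> nat)); rewrite size_polyX size_polyC; case: eqP.
  have : 'X * b%:P = 1.
    by apply: phi_inj; rewrite rmorphM rmorph1 -[phi b%:P]bX divff // phi_eq0 ?polyX_eq0.
  by move=> /(congr1 (horner^~ 0)); rewrite hornerM hornerX mul0r -polyC1 hornerC => /eqP;
     rewrite eq_sym oner_eq0.
have nR' k : R' <> P (w k).
  move=> R'P; apply: (nR k); apply: Q_unique => z; rewrite -R'P.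
  have [->|z0] := eqVneq z 0; first by rewrite scale0r; split=> _; exact: maxideal0.
  rewrite !maxidealV // ?scale1_eq0 // R'R.
  by rewrite -[z^-1%:A]/(in_alg F z^-1) fmorphV.
apply: (vringX_root m_gt0); have -> : (a *: y ^- i) ^+ m = (a ^+ m / phi f ^+ i)%:A.
  rewrite exprZn exprVn -exprM mulnC exprM yP -[(phi f)%:A]/(in_alg F (phi f)).
  by rewrite -(rmorphXn (in_alg F)) -(fmorphV (in_alg F)) /= scalerA.
by apply/R'R/adm.
Qed.

Lemma radical_semigroupP (al : 'rV[int]_n) : wsemigroup Q al <->
  forall k, exists i (j : 'I_n -> int), [/\ s i <= \sum_l j l,
    al 0 k = m%:Z * j k + T i k & forall l, m%:Z * j l + T i l <= al 0 l].
Proof.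
have nu_sum k (a : 'I_m -> E) := @nu_sum_scale _ _ _ _ _ _ (ram k) (dQ k) _ _ yi0 (@yi_dist k) a.
have value (k : 'I_n) a (i : 'I_m) : - (m%:Z * nu (P (w k)) a + - (i%:Z * lam (w k))) =
    m%:Z * (fl (w k) i - nu (P (w k)) a) + T i k.
  by rewrite T_def; ring.
split=> [[z [z_reg /eqP z0] <-] k|class].
  have [a zE] := ramified_expansion (ram k0) (dQ k0) dimF yi0 (@yi_dist k0) z.
  have a_neq0 : exists i, a i != 0.
    apply: contrapT => a0; move/eqP: z0; apply; rewrite zE big1 // => i _.
    by have [->|ai] := eqVneq (a i) 0; [rewrite scale0r|case: a0; exists i].
  have [i [ai _ nuz _]] := nu_sum k a a_neq0.
  rewrite -zE dimF nu_yi in nuz.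
  exists i, (fun l => fl (w l) i - nu (P (w l)) (a i)); split.
  - by apply: admissible_degree => //; apply: regular_admissible; rewrite -zE.
  - by rewrite mxE nuz value.
  - move=> l; rewrite mxE -value lerN2.
    have [i' [_ _ nuz' mini]] := nu_sum l a a_neq0.
    by have := mini i ai; rewrite -nuz' -zE dimF nu_yi.
(* [J i] indexes the greatest vector of class i below al. Including a term for every class whose
   [J i] meets the degree condition makes one function serve all k. *)
pose J (i : 'I_m) (l : 'I_n) := ((al 0 l - T i l)%R %/ m%:Z)%Z.
have m_gt0Z : 0 < m%:Z by [].
have JT (i : 'I_m) l : m%:Z * J i l + T i l <= al 0 l.
  by rewrite -lerBrDr mulrC lez_floor // gt_eqF.
have J_max (i : 'I_m) l v : m%:Z * v + T i l <= al 0 l -> v <= J i l.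
  by move=> h; rewrite /J lez_divRL // mulrC lerBrDr.
pose present (i : 'I_m) := s i <= \sum_l J i l.
have coef i : exists a, if present i then [/\ a != 0, admissible a i &
    forall k, nu (P (w k)) a = fl (w k) i - J i k] else a = 0.
  case: (boolP (present i)) => [pi|_]; last by exists 0.
  by have [a aP] := @admissible_exists i (J i) pi; exists a.
have {coef}[a aP] := choice coef.
have a0P i : (a i != 0) = present i.
  by have := aP i; case: (present i) => [[-> _ _]|->] //; rewrite eqxx.
have witness k : exists i, a i != 0 /\ al 0 k = m%:Z * J i k + T i k.
  have [i [j [le_s alk le_al]]] := class k; exists i; split.
    rewrite a0P; apply: (le_trans le_s); apply: ler_sum => l _.
    exact: J_max.
  apply/eqP; rewrite eq_le JT andbT alk lerD2r ler_pM2l //.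
  exact: J_max.
have a_neq0 : exists i, a i != 0 by have [i [ai _]] := witness k0; exists i.
have value' k i : a i != 0 -> m%:Z * nu (P (w k)) (a i) + nu (Q k) (y ^- i) =
    - (m%:Z * J i k + T i k).
  rewrite a0P => pi; have := aP i; rewrite pi => -[_ _ nua].
  by apply: oppr_inj; rewrite nu_yi value nua opprK; congr (_ * _ + _); ring.
exists (\sum_i a i *: y ^- i).
  split; last by have [i [_ S0 _ _]] := nu_sum k0 a a_neq0; exact/eqP.
  move=> R nR; apply: vring_sum => i _; have := aP i; case: ifP => [_ [_ adm _]|_ ->].
    exact: admissible_regular.
  by rewrite scale0r; exact: vring0.
apply/rowP => k; rewrite mxE; have [i [ai _ nuS mini]] := nu_sum k a a_neq0.
rewrite dimF in nuS mini; rewrite nuS value' // opprK.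
have [i' [ai' alk]] := witness k; apply/eqP; rewrite eq_le JT /=.
by rewrite alk -lerN2 -!value' //; exact: mini.
Qed.

Let beta (i : nat) : int := \sum_(k < r) cl k i - 1.

(** For 0 < i < m no i lambda_k at an inner place is divisible by m, so each of the n ceilings
    exceeds its floor by exactly 1. *)
Let sE (i : 'I_m) : s i = if i == 0%N :> nat then 0 else beta i + 1 - n%:Z.
Proof.
rewrite /s; case: eqP => [i0|/eqP i0].
  rewrite !big1 ?addr0 // => k _; rewrite /cl /fl i0 mul0r ?div0z //.
  by rewrite mul0r Num.Theory.ceil0.
have clE k : cl (w k) i = fl (w k) i + 1.
  have Ti_ge0 : 0 <= T i k by rewrite modz_ge0 // gt_eqF.
  have Ti_lt : T i k < m%:Z by rewrite ltz_pmod.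
  have Ti_neq0 : T i k != 0.
    apply: contra i0 => /eqP Ti0; pose z0 : 'I_m := Ordinal m_gt0.
    suff -> : i = z0 by [].
    by apply: (@lam_inj k i z0 (fl (w k) i)); rewrite T_def Ti0 mul0r; ring.
  apply/eqP; rewrite eq_le ceil_le T_def mulrDr mulr1 lerD2l (ltW Ti_lt) /=.
  rewrite -ltzD1 ltrD2r ltNge ceil_le T_def -[X in _ <= X]addr0 lerD2l -ltNge.
  by rewrite lt_neqAle eq_sym Ti_neq0.
rewrite /beta sum_split; under [in RHS]eq_bigr do rewrite clE.
rewrite big_split /= sumr_const card_ord natz.
move: (\sum_(k < n) _) (\sum_(k < r | _) _) => A B; lia.
Qed.

Lemma radical_class_set (rho : int) :
  [set a | exists (i : 'I_m) (j : 'I_n -> int),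
     \sum_l j l = s i + rho /\ a = \row_k (m%:Z * j k + T i k)] =
  [set a | exists (i : nat) (j : 'I_n -> int),
     [/\ (1 <= i <= m - 1)%N, \sum_(k < n) j k = beta i + 1 - n%:Z + rho &
         a = \row_k (m%:Z * j k + ((i%:Z * lam (w k)) %% m%:Z)%Z)]] `|`
  [set a | exists j : 'I_n -> int, \sum_(k < n) j k = rho /\ a = \row_k (m%:Z * j k)].
Proof.
apply/seteqP; split=> a.
  move=> [i [j []]]; rewrite sE; case: eqP => [i0|/eqP i0] sj ->.
    right; exists j; rewrite sj add0r; split=> //; apply/rowP => k.
    by rewrite !mxE /T i0 mul0r mod0z addr0.
  by left; exists i, j; split=> //; have := ltn_ord i; lia.
move=> [[i [j [lt_i sj ->]]]|[j [sj ->]]].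
  have lt_im : (i < m)%N by lia.
  exists (Ordinal lt_im), j; split=> //; rewrite sE sj /=; case: eqP => // i0.
  by rewrite i0 in lt_i.
exists (Ordinal m_gt0), j; rewrite sE /= add0r; split=> //; apply/rowP => k.
by rewrite !mxE /T mul0r mod0z addr0.
Qed.

End RadicalSemigroup.

(** * Specialization to the field of fractions of K[x] *)

Lemma fraction_quotient (R : idomainType) (z : {fraction R}) :
  exists u v : R, v != 0 /\ z = tofrac u / tofrac v.
Proof.
elim/quotW: z => x; exists \n_x, \d_x; split; first exact: denom_ratioP.
apply: (canRL (mulfK _)); first by rewrite tofrac_eq0 denom_ratioP.
unlock FracField.tofrac; rewrite -[LHS]FracField.pi_mul /FracField.mulf !numden_Ratio ?oner_eq0 //.
rewrite mulr1; apply/eqmodP; rewrite /= FracField.equivfE.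
by rewrite !numden_Ratio ?oner_eq0 ?denom_ratioP // mulr1 mulrC.
Qed.

(** Split f in some extension; all roots come from K, so the factorization descends along the
    injective map on polynomials. *)
Lemma split_over_base (K : fieldType) (f : {poly K}) : f != 0 ->
  (forall (L : fieldType) (iota : {rmorphism K -> L}) (a : L),
     root (map_poly iota f) a -> exists b, a = iota b) ->
  exists rs : seq K, f = lead_coef f *: \prod_(b <- rs) ('X - b%:P).
Proof.
move=> f0 f_roots; have [L [iota [rs fE]]] := splitting_extension f0.
have [bs rsE] : exists bs, rs = map iota bs.
  have : forall a, a \in rs -> exists b, a = iota b.
    move=> a a_rs; apply: (f_roots L); rewrite fE rootZ ?fmorph_eq0 ?lead_coef_eq0 //.
    by rewrite root_prod_XsubC.
  elim: {fE} rs => [|a rs IHrs] rsP; first by exists [::].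
  have [b ->] := rsP a (mem_head _ _).
  have [x xrs|bs ->] := IHrs; first by apply: rsP; rewrite inE xrs orbT.
  by exists (b :: bs).
exists bs; apply: (map_poly_inj iota); rewrite fE rsE linearZ /= rmorph_prod big_map.
by congr (_ *: _); apply: eq_bigr => b _; rewrite rmorphB /= map_polyX map_polyC.
Qed.

Theorem theorem3p4 (K : finFieldType) (m : nat) (f : {poly K})
    (hm : (2 <= m)%N)
    (hchar : forall p : nat, p \in [pchar K] -> ~~ (p %| m)%N)
    (hdeg : (2 <= (size f).-1)%N)
    (hroots : forall (L : fieldType) (iota : {rmorphism K -> L}) (a : L),
       root (map_poly iota f) a -> exists b : K, a = iota b)
    (hpow : forall d : nat, (d %| m)%N -> (1 < d)%N ->
       forall g : {fraction {poly K}}, g ^+ d <> tofrac f)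
    (F : fieldExtType {fraction {poly K}}) (y : F)
    (hy : y ^+ m = (tofrac f)%:A)
    (hF : <<1; y>>%VS = fullv)
    (r n : nat) (P : 'I_r -> place (ratfun_const K))
    (hPinj : injective P)
    (hP : range P = [set R | 0 < nu R (tofrac f) \/ nu R (tofrac f) < 0])
    (hnr : (n <= r)%N)
    (hram : forall k : 'I_n, totally_ramified F (P (widen_ord hnr k)))
    (Q : 'I_n -> place (ext_const F))
    (hQ : forall k : 'I_n, lies_over (Q k) (P (widen_ord hnr k)))
    (hn2 : (2 <= n)%N) (hnq : (n <= #|K|)%N) :
  let lam (k : 'I_r) : int := nu (P k) (tofrac f) in
  let t (k : 'I_n) (i : nat) : int :=
    ((i%:Z * lam (widen_ord hnr k)) %% m%:Z)%Z in
  let beta (i : nat) : int :=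
    (\sum_(k < r) Num.ceil ((i%:Z * lam k)%:~R / m%:R : rat)) - 1 in
  let S (rho : int) : set 'rV[int]_n :=
    [set a | exists (i : nat) (j : 'I_n -> int),
       [/\ (1 <= i <= m - 1)%N,
           \sum_(k < n) j k = beta i + 1 - n%:Z + rho
         & a = \row_k (m%:Z * j k + t k i)]] `|`
    [set a | exists j : 'I_n -> int,
       \sum_(k < n) j k = rho /\ a = \row_k (m%:Z * j k)] in
  absolute_maximal Q = S 0 /\ relative_maximal Q = S (n%:Z - 2).
Proof.
move=> lam t beta S.
have m_gt0 : (0 < m)%N := ltnW hm.
have m_neq0 : m%:R != 0 :> K.
  apply/negP => m0; have [p pK] := natf0_pchar m_gt0 m0.
  by have := hchar p pK; rewrite (dvdn_pcharf pK) m0.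
have f_size : (1 < size f)%N by case: (size f) hdeg => [|[]].
have f0 : f != 0 by rewrite -size_poly_gt0 ltnW.
have [rs f_split] := split_over_base f0 hroots.
have P_range R : (exists k, P k = R) <-> nu R (tofrac f) != 0.
  have -> : (exists k, P k = R) <-> range P R.
    by split=> [[k <-]|[k _ <-]]; exists k.
  by rewrite hP neq_lt orbC; split=> [[->|->]|/orP[]]; rewrite ?orbT //=; [left|right].
have Q_unique k R : lies_over R (P (widen_ord hnr k)) -> R = Q k.
  by have [Q' [_ uniq _]] := hram k => /uniq ->; rewrite (uniq _ (hQ k)).
have ram k : ramification_index (Q k) (P (widen_ord hnr k)) (\dim {:F}).
  by have [Q' [/Q_unique -> _]] := hram k.
have n_gt0 : (0 < n)%N := ltnW hn2.
have m_gt0Z : 0 < m%:Z by [].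
have tofrac_inj : injective (@tofrac {poly K}) by move=> u v /eqP; rewrite tofrac_eq => /eqP.
have T_inj := @radical_class_inj K _ _ tofrac_inj (@fraction_quotient _) m f rs m_gt0 m_neq0
  f_split f_size hpow F y hy hF r n P P_range hnr n_gt0 hnq Q hQ ram.
have semi := @radical_semigroupP K _ _ tofrac_inj (@fraction_quotient _) m f rs m_gt0 m_neq0
  f_split f_size hpow F y hy hF r n P hPinj P_range hnr n_gt0 hnq Q hQ Q_unique ram.
have class_set := @radical_class_set K _ _ tofrac_inj (@fraction_quotient _) m f rs m_gt0
  m_neq0 f_split f_size hpow F y hy hF r n P P_range hnr n_gt0 hnq Q hQ ram.
split.
  rewrite (absolute_maximalE m_gt0Z hn2 T_inj semi) /S -class_set.
  by apply/seteqP; split=> a [i [j [sj ->]]]; exists i, j; rewrite sj ?addr0.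
by rewrite (relative_maximalE m_gt0Z hn2 T_inj semi) /S -class_set.
Qed.
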